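(* Let $\mathcal{M}\subset\mathbb{R}^M$ be a smooth embedded submanifold of dimension $m\le M$ equipped with the Riemannian metric inherited from $\mathbb{R}^M$, let $F:\mathcal{M}\to\mathbb{R}^N$ be a smooth map, let $f:\mathcal{M}\to\mathbb{R}$, $f(p)=\tfrac12\|F(p)\|^2$, and let $R$ be a retraction on $\mathcal{M}$. Assume that $\mathbf{x}_\star\in\mathcal{M}$ is a local minimum of $f$ and that the derivative $\mathrm{d}_{\mathbf{x}_\star}F:\mathrm{T}_{\mathbf{x}_\star}\mathcal{M}\to\mathbb{R}^N$ is injective. Let $\kappa:=(\varsigma_m(\mathrm{d}_{\mathbf{x}_\star}F))^{-1}>0$. Then there exists $\epsilon'>0$ such that for all $0<\alpha<1$ there exists a universal constant $c>0$, depending on $\epsilon'$, $F$, $\mathbf{x}_\star$, $\mathcal{M}$ and $R$, so that the following holds. 1. (Linear convergence) If $\frac{c\kappa^2\|F(\mathbf{x}_\star)\|}{\alpha}<1$, then for all $\mathbf{x}_0\in B_\epsilon(\mathbf{x}_\star)\cap\mathcal{M}$ with $$\epsilon:=\min\Bigl\{\frac{1-\alpha}{c\kappa},\ \frac{\alpha\epsilon'}{1+\alpha+c\kappa^2\|F(\mathbf{x}_\star)\|}\Bigr\},$$ the Riemannian Gauss--Newton (RGN) method for $f$ with retraction $R$ started at $\mathbf{x}_0$ generates a sequence $\mathbf{x}_0,\mathbf{x}_1,\ldots$ that converges linearly to $\mathbf{x}_\star$. In fact, $$\|\mathbf{x}_\star-\mathbf{x}_{k+1}\|\le\frac{c\kappa^2\|F(\mathbf{x}_\star)\|}{\alpha}\,\|\mathbf{x}_\star-\mathbf{x}_k\|+\mathcal{O}(\|\mathbf{x}_\star-\mathbf{x}_k\|^2).$$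 2. (Quadratic convergence) If $\mathbf{x}_\star$ is a zero of the objective function $f$, then for all $\mathbf{x}_0\in B_\epsilon(\mathbf{x}_\star)\cap\mathcal{M}$ with $$\epsilon:=\min\Bigl\{\frac{1-\alpha}{c\kappa},\ \frac{\alpha\epsilon'}{1+\alpha}\Bigr\},$$ the RGN method for $f$ with retraction $R$ started at $\mathbf{x}_0$ generates a sequence $\mathbf{x}_0,\mathbf{x}_1,\ldots$ that converges quadratically to $\mathbf{x}_\star$. In fact, $$\|\mathbf{x}_\star-\mathbf{x}_{k+1}\|\le\frac{c(\kappa+1)}{\alpha}\,\|\mathbf{x}_\star-\mathbf{x}_k\|^2+\mathcal{O}(\|\mathbf{x}_\star-\mathbf{x}_k\|^3).$$
   Context: Each tangent space $\mathrm{T}_p\mathcal{M}$ is regarded as a linear subspace of $\mathbb{R}^M$ with the standard inner product; $\|\cdot\|$ is the Euclidean norm (on $\mathbb{R}^M$ and $\mathbb{R}^N$). $B_\tau(\mathbf{x})$ is the ball of radius $\tau$ centered at $\mathbf{x}\in\mathbb{R}^M$. $\mathrm{d}_pF:\mathrm{T}_p\mathcal{M}\to\mathbb{R}^N$ is the derivative of $F$ at $p$, and $\varsigma_m(A)$ denotes the $m$th largest singular value of a linear operator $A$ (so $\varsigma_m(\mathrm{d}_{\mathbf{x}_\star}F)$ is the smallest singular value of the injective map $\mathrm{d}_{\mathbf{x}_\star}F$ on the $m$-dimensional space $\mathrm{T}_{\mathbf{x}_\star}\mathcal{M}$). Retraction: let $\mathcal{T}\mathcal{M}=\{(p,\mathbf{v})\mid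 p\in\mathcal{M},\ \mathbf{v}\in\mathrm{T}_p\mathcal{M}\}$ be the tangent bundle and $0_p$ the zero element of $\mathrm{T}_p\mathcal{M}$. A retraction $R$ is a map $\mathcal{U}\to\mathcal{M}$ from an open subset $\mathcal{U}\subset\mathcal{T}\mathcal{M}$ such that for every $p\in\mathcal{M}$: (1) $R(p,0_p)=p$; (2) $\mathcal{U}$ contains a neighborhood $\mathcal{N}$ of $(p,0_p)$ such that $R|_{\mathcal{N}}$ is smooth; (3) $\mathrm{d}_{0_x}R(x,\cdot)=\mathrm{id}_{\mathrm{T}_x\mathcal{M}}$ for all $(x,0_x)\in\mathcal{N}$. One writes $R_p(\cdot):=R(p,\cdot)$. RGN method: given $\mathbf{x}_0\in\mathcal{M}$, the iterates are defined, as long as $\mathrm{d}_{\mathbf{x}_k}F$ is injective, by $$\mathbf{x}_{k+1}=R_{\mathbf{x}_k}(\eta_k),\qquad \eta_k=-(\mathrm{d}_{\mathbf{x}_k}F)^\dagger\bigl(F(\mathbf{x}_k)\bigr):=-\bigl((\mathrm{d}_{\mathbf{x}_k}F)^*\circ(\mathrm{d}_{\mathbf{x}_k}F)\bigr)^{-1}(\mathrm{d}_{\mathbf{x}_k}F)^*\bigl(F(\mathbf{x}_k)\bigr)\in\mathrm{T}_{\mathbf{x}_k}\mathcal{M},$$ where $A^*$ denotes the adjoint of $A$ with respect to the standard inner products. No globalization strategy (line search or trust region) is used. *)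

(* Defs.v *)
From HB Require Import structures.
From mathcomp Require Import all_boot all_order all_algebra.
From mathcomp Require Import all_classical all_reals all_analysis.

Set Implicit Arguments.
Unset Strict Implicit.
Unset Printing Implicit Defensive.

Import Order.TTheory GRing.Theory Num.Theory.
Import numFieldNormedType.Exports.

Local Open Scope classical_set_scope.
Local Open Scope ring_scope.

(* The Euclidean norm; the library's norm on matrices is the max norm, which
   induces the same topology. *)
Definition enorm (R : realType) n (x : 'rV[R]_n) : R :=
  Num.sqrt (\sum_i x 0 i ^+ 2).

Definition eball (R : realType) n (x : 'rV[R]_n) (r : R) : set 'rV[R]_n :=
  [set y | enorm (y - x) <= r].

(* Meaningful for O open: f is of class C^0 iff it is continuous, and of class
   C^(k+1) iff it is differentiable with all its directional derivatives of
   class C^k. *)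
Fixpoint class_C (R : realType) (V W : normedModType R) (k : nat) (O : set V)
    (f : V -> W) : Prop :=
  if k is k'.+1 then
    (forall x, O x -> differentiable f x) /\ (forall v, class_C k' O ('D_v f))
  else forall x, O x -> {for x, continuous f}.

Definition smooth (R : realType) (V W : normedModType R) (O : set V)
    (f : V -> W) : Prop := forall k, class_C k O f.

(* Smoothness on an arbitrary subset: local existence of smooth extensions. *)
Definition smooth_on (R : realType) (V W : normedModType R) (A : set V)
    (f : V -> W) : Prop :=
  forall x, A x -> exists O (g : V -> W),
    [/\ open_nbhs x O, smooth O g & forall y, O y -> A y -> f y = g y].

(* Around each of its points, S is mapped to an open part of R^m x {0} by a
   diffeomorphism Phi, with inverse Psi, between open subsets of R^M. *)
Definition embedded_submanifold (R : realType) M (m : nat)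
    (S : set 'rV[R]_M) : Prop :=
  forall p, S p -> exists (O W : set 'rV[R]_M) (Phi Psi : 'rV[R]_M -> 'rV[R]_M),
    [/\ open_nbhs p O, open W, smooth O Phi, smooth W Psi &
      [/\ Phi @` O = W,
          forall x, O x -> Psi (Phi x) = x &
          forall x, O x ->
            (S x <-> forall i : 'I_M, (m <= i)%N -> Phi x 0 i = 0)]].

Section Submanifold.
Variables (R : realType) (M N : nat) (S : set 'rV[R]_M).

Definition curve_through (p v : 'rV[R]_M) (g : R -> 'rV[R]_M) : Prop :=
  exists2 O : set R, open_nbhs (0 : R) O &
    [/\ smooth O (g : R^o -> 'rV[R]_M), forall t, O t -> S (g t),
        g 0 = p & is_derive (0 : R) (1 : R) g v].

Definition tangent_space (p : 'rV[R]_M) : set 'rV[R]_M :=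
  [set v | exists g, curve_through p v g].

Definition tangent_bundle : set ('rV[R]_M * 'rV[R]_M) :=
  [set pv | S pv.1 /\ tangent_space pv.1 pv.2].

(* The derivative of F : S -> R^N at p, applied to the tangent vector v, is
   (F o g)'(0) for any smooth curve g in S with g(0) = p and g'(0) = v. *)
Definition mdiff (F : 'rV[R]_M -> 'rV[R]_N) (p v : 'rV[R]_M) : 'rV[R]_N :=
  get [set w | exists2 g, curve_through p v g &
                          is_derive (0 : R) (1 : R) (F \o g) w].

Definition mdiff_injective (F : 'rV[R]_M -> 'rV[R]_N) (p : 'rV[R]_M) : Prop :=
  forall u v, tangent_space p u -> tangent_space p v ->
    mdiff F p u = mdiff F p v -> u = v.

Definition tangent_onb (m : nat) (p : 'rV[R]_M) : 'M[R]_(m, M) :=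
  get [set B | B *m B^T = 1%:M /\
               forall v, tangent_space p v <-> (v <= B)%MS].

(* The matrix of the derivative of F at p in the basis tangent_onb m p, acting
   on row vectors of coordinates from the right. As the basis is orthonormal,
   the adjoint of the derivative is represented by the transpose matrix. *)
Definition mdiff_mx (m : nat) (F : 'rV[R]_M -> 'rV[R]_N) (p : 'rV[R]_M) :
    'M[R]_(m, N) :=
  \matrix_i mdiff F p (row i (tangent_onb m p)).

End Submanifold.

(* Since matrices act from the right, A *m A^T represents A^* o A. *)
Definition singular_values (R : realType) m n (A : 'M[R]_(m, n)) : seq R :=
  xget [::] [set s | [/\ sorted >=%R s, all (fun a => 0 <= a) s &
    char_poly (A *m A^T) = \prod_(a <- s) ('X - (a ^+ 2)%:P)]].

(* The k-th largest singular value, for k >= 1. *)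
Definition singular_value (R : realType) m n (k : nat) (A : 'M[R]_(m, n)) : R :=
  nth 0 (singular_values A) k.-1.

(* (A^* o A)^-1 o A^*, for an injective A acting from the right. *)
Definition pinv_inj (R : realType) m n (A : 'M[R]_(m, n)) : 'M[R]_(n, m) :=
  A^T *m invmx (A *m A^T).

(* A retraction is a function on the tangent bundle with domain U; the values
   of Ret outside U are irrelevant. *)
Definition retraction (R : realType) M (S : set 'rV[R]_M)
    (U : set ('rV[R]_M * 'rV[R]_M)) (Ret : 'rV[R]_M * 'rV[R]_M -> 'rV[R]_M) :
    Prop :=
  let TS := tangent_bundle S in
  [/\ exists2 O : set ('rV[R]_M * 'rV[R]_M), open O & U = O `&` TS,
      forall pv, U pv -> S (Ret pv) &
      forall p, S p ->
        Ret (p, 0) = p /\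
        exists2 O : set ('rV[R]_M * 'rV[R]_M), open_nbhs (p, 0 : 'rV[R]_M) O &
          [/\ O `&` TS `<=` U,
              smooth_on (O `&` TS) Ret &
              forall x, S x -> O (x, 0) -> forall v, tangent_space S x v ->
                is_derive (0 : R) (1 : R) (fun t : R => Ret (x, t *: v)) v]].

Section RGN.
Variables (R : realType) (M N m : nat) (S : set 'rV[R]_M).
Variables (F : 'rV[R]_M -> 'rV[R]_N).
Variables (U : set ('rV[R]_M * 'rV[R]_M)).
Variables (Ret : 'rV[R]_M * 'rV[R]_M -> 'rV[R]_M).

Definition objective (p : 'rV[R]_M) : R := 2^-1 * enorm (F p) ^+ 2.

Definition rgn_direction (p : 'rV[R]_M) : 'rV[R]_M :=
  - (F p *m pinv_inj (mdiff_mx S m F p) *m tangent_onb S m p).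

Definition rgn (x0 : 'rV[R]_M) (k : nat) : 'rV[R]_M :=
  iter k (fun x => Ret (x, rgn_direction x)) x0.

(* The iteration never breaks down. *)
Definition rgn_well_defined (x0 : 'rV[R]_M) : Prop :=
  forall k, [/\ S (rgn x0 k), mdiff_injective S F (rgn x0 k) &
                U (rgn x0 k, rgn_direction (rgn x0 k))].

End RGN.

Definition converges_linearly (R : realType) M (x : nat -> 'rV[R]_M)
    (l : 'rV[R]_M) : Prop :=
  x @ \oo --> l /\
  exists2 rho : R, 0 < rho < 1 &
    \forall k \near \oo, enorm (l - x k.+1) <= rho * enorm (l - x k).

Definition converges_quadratically (R : realType) M (x : nat -> 'rV[R]_M)
    (l : 'rV[R]_M) : Prop :=
  x @ \oo --> l /\
  exists2 C : R, 0 < C &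
    \forall k \near \oo, enorm (l - x k.+1) <= C * enorm (l - x k) ^+ 2.

(* Main.v *)
Require Import Defs.
From HB Require Import structures.
From mathcomp Require Import all_boot all_order all_algebra.
From mathcomp Require Import complex.
From mathcomp Require Import all_classical all_reals all_analysis.
From mathcomp Require Import ring lra.
Set Implicit Arguments.
Unset Strict Implicit.
Unset Printing Implicit Defensive.
Import Order.TTheory GRing.Theory Num.Theory.
Import numFieldNormedType.Exports.
Local Open Scope classical_set_scope.
Local Open Scope ring_scope.

(** Let x be a point of S near xs, let T_x be the tangent space and D_x the
    derivative of F there, and let d be the distance from x to xs. The
    Gauss-Newton direction eta minimizes the norm of F(x) + D_x eta over T_x.

    The secant xs - x agrees with some w in T_x up to O(d^2), so that
    F(xs) = F(x) + D_x w + O(d^2) (tangent_estimates). The normal equations of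
    the least-squares problem then say that F(xs) + D_x (eta - w) + O(d^2) is
    orthogonal to the range of D_x. Since xs is a local minimum, F(xs) is
    orthogonal to the range of D_xs (local_min_dot_eq0); as T_x and D_x depend on
    x in a Lipschitz way, F(xs) is orthogonal to the range of D_x up to
    O(|F(xs)| d). Moreover D_x is bounded below on T_x, uniformly in x, because
    D_xs is injective. Together (pinv_inj_estimate) this gives
    eta - w = O(|F(xs)| d + d^2). Finally a retraction maps (x, eta) to
    x + eta + O(|eta|^2), uniformly in x (retraction_estimate). Adding up, one step
    of the method leads to a point at distance at most K1 |F(xs)| d + K2 d^2 of xs
    (rgn_step_estimate).

    The convergence statements follow as soon as c is so large that
    K1 <= c kappa^2 and 2 K2 <= c kappa: with these constants every step that
    starts in the ball of radius eps shrinks the distance to xs by the factor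
    (1 + alpha) / 2, so that the iterates stay in the ball.

    All remainders are uniform in x because they come from Taylor formulas for
    maps of class C^2 on an open set of a vector space (C2_estimates): a chart of
    S, its inverse, and local extensions of F and of the retraction. In a chart
    the tangent spaces, which are defined by curves, become linear spaces of
    dimension m (chart_tangent), and then F has a derivative in the usual sense
    (mdiffE). That kappa is positive requires the singular values to exist, that
    is, the spectral theorem for real symmetric matrices (singular_valuesP). *)

(** * The Euclidean inner product *)

Definition dot (R : realType) n (u v : 'rV[R]_n) : R := (u *m v^T) 0 0.

Lemma dotE (R : realType) n (u v : 'rV[R]_n) :
  dot u v = \sum_i u 0 i * v 0 i.
Proof. by rewrite /dot mxE; apply: eq_bigr => i _; rewrite mxE. Qed.

Lemma dotC (R : realType) n (u v : 'rV[R]_n) : dot u v = dot v u.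
Proof. by rewrite !dotE; apply: eq_bigr => i _; rewrite mulrC. Qed.

Lemma dotDl (R : realType) n (u v w : 'rV[R]_n) :
  dot (u + v) w = dot u w + dot v w.
Proof. by rewrite /dot mulmxDl mxE. Qed.

Lemma dotZl (R : realType) n a (u w : 'rV[R]_n) : dot (a *: u) w = a * dot u w.
Proof. by rewrite /dot -scalemxAl mxE. Qed.

Lemma dotNl (R : realType) n (u w : 'rV[R]_n) : dot (- u) w = - dot u w.
Proof. by rewrite /dot mulNmx mxE. Qed.

Lemma dotDr (R : realType) n (u v w : 'rV[R]_n) :
  dot w (u + v) = dot w u + dot w v.
Proof. by rewrite !(dotC w) dotDl. Qed.

Lemma dotZr (R : realType) n a (u w : 'rV[R]_n) : dot w (a *: u) = a * dot w u.
Proof. by rewrite !(dotC w) dotZl. Qed.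

Lemma dotNr (R : realType) n (u w : 'rV[R]_n) : dot w (- u) = - dot w u.
Proof. by rewrite !(dotC w) dotNl. Qed.

Lemma dot_mulmxl (R : realType) n p (u : 'rV[R]_n) (A : 'M[R]_(n, p)) v :
  dot (u *m A) v = dot u (v *m A^T).
Proof. by rewrite /dot trmx_mul trmxK mulmxA. Qed.

Lemma dot_ge0 (R : realType) n (u : 'rV[R]_n) : 0 <= dot u u.
Proof. by rewrite dotE sumr_ge0// => i _; rewrite -expr2 sqr_ge0. Qed.

Lemma sqr_enorm (R : realType) n (u : 'rV[R]_n) : enorm u ^+ 2 = dot u u.
Proof.
rewrite /enorm sqr_sqrtr; last by rewrite sumr_ge0// => i _; rewrite sqr_ge0.
by rewrite dotE; apply: eq_bigr => i _; rewrite expr2.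
Qed.

Lemma enorm_ge0 (R : realType) n (u : 'rV[R]_n) : 0 <= enorm u.
Proof. exact: sqrtr_ge0. Qed.

Lemma dot_eq0 (R : realType) n (u : 'rV[R]_n) : dot u u = 0 -> u = 0.
Proof.
rewrite dotE => /eqP; rewrite psumr_eq0; last first.
  by move=> i _; rewrite -expr2 sqr_ge0.
move=> /allP u0; apply/rowP => i; rewrite mxE.
by have := u0 i (mem_index_enum i); rewrite mulf_eq0 orbb => /eqP.
Qed.

Lemma enorm_eq0 (R : realType) n (u : 'rV[R]_n) : enorm u = 0 -> u = 0.
Proof. by move=> u0; apply: dot_eq0; rewrite -sqr_enorm u0 expr0n. Qed.

Lemma enorm0 (R : realType) n : enorm (0 : 'rV[R]_n) = 0.
Proof.
by apply/eqP; rewrite -sqrf_eq0 sqr_enorm /dot mul0mx mxE.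
Qed.

Lemma enormN (R : realType) n (u : 'rV[R]_n) : enorm (- u) = enorm u.
Proof.
by rewrite /enorm; congr Num.sqrt; apply: eq_bigr => i _; rewrite mxE sqrrN.
Qed.

Lemma enormB (R : realType) n (u v : 'rV[R]_n) : enorm (u - v) = enorm (v - u).
Proof. by rewrite -enormN opprB. Qed.

Lemma Cauchy_Schwarz (R : realType) n (u v : 'rV[R]_n) :
  dot u v <= enorm u * enorm v.
Proof.
have [v0|v0] := eqVneq (enorm v) 0.
  by rewrite (enorm_eq0 v0) dotC /dot mul0mx mxE enorm0 mulr0.
have vp : 0 < enorm v by rewrite lt0r v0 enorm_ge0.
have [u0|u0] := eqVneq (enorm u) 0.
  by rewrite (enorm_eq0 u0) /dot mul0mx mxE enorm0 mul0r.
have up : 0 < enorm u by rewrite lt0r u0 enorm_ge0.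
have := dot_ge0 (enorm v *: u - enorm u *: v).
rewrite !(dotDl, dotDr, dotNl, dotNr, dotZl, dotZr) -!sqr_enorm (dotC v u).
move: vp up (dot u v); move: (enorm u) (enorm v) => a b b0 a0 d.
set X := (X in 0 <= X -> _).
have -> : X = 2 * (a * b) * (a * b - d) by rewrite /X; ring.
by rewrite pmulr_rge0 ?mulr_gt0// subr_ge0.
Qed.

Lemma normr_dot_le (R : realType) n (u v : 'rV[R]_n) :
  `|dot u v| <= enorm u * enorm v.
Proof.
rewrite ler_norml Cauchy_Schwarz andbT lerNl -dotNl -(enormN u).
exact: Cauchy_Schwarz.
Qed.

Lemma enormD (R : realType) n (u v : 'rV[R]_n) :
  enorm (u + v) <= enorm u + enorm v.
Proof.
rewrite -(@ler_pXn2r _ 2)// ?nnegrE ?addr_ge0 ?enorm_ge0//.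
rewrite sqrrD !sqr_enorm !(dotDl, dotDr) (dotC v u).
have := Cauchy_Schwarz u v; lra.
Qed.

Lemma coord_le_norm (R : realType) m n (A : 'M[R]_(m, n)) i j :
  `|A i j| <= `|A|.
Proof.
rewrite [leRHS]/Num.Def.normr/= mx_normrE.
exact: (le_bigmax _ (fun ij : 'I_m * 'I_n => `|A ij.1 ij.2|) (i, j)).
Qed.

Lemma norm_le_coord (R : realType) n (u : 'rV[R]_n) (e : R) : 0 <= e ->
  (forall j, `|u 0 j| <= e) -> `|u| <= e.
Proof.
move=> e0 ue; rewrite [leLHS]/Num.Def.normr/= mx_normrE.
by apply: bigmax_le => // -[i j] _ /=; rewrite ord1.
Qed.

Lemma norm_le_enorm (R : realType) n (u : 'rV[R]_n) : `|u| <= enorm u.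
Proof.
apply: norm_le_coord => [|j]; first exact: enorm_ge0.
rewrite -sqrtr_sqr ler_wsqrtr// (bigD1 j)//= lerDl sumr_ge0// => i _.
exact: sqr_ge0.
Qed.

Lemma enorm_le_norm (R : realType) n (u : 'rV[R]_n) :
  enorm u <= n%:R * `|u|.
Proof.
rewrite -(@ler_pXn2r _ 2)// ?nnegrE ?enorm_ge0 ?mulr_ge0//.
rewrite sqr_enorm dotE.
apply: (@le_trans _ _ (\sum_(i < n) `|u| ^+ 2)).
  apply: ler_sum => i _; rewrite -expr2 -(real_normK (num_real _)).
  by rewrite ler_pXn2r ?nnegrE// coord_le_norm.
rewrite sumr_const card_ord -[leLHS]mulr_natl exprMn ler_wpM2r ?sqr_ge0//.
by rewrite -natrX ler_nat; case: n u => // k _; exact: leq_pmulr.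
Qed.

Lemma enorm_mulmx_bounded (R : realType) n p (A : 'M[R]_(n, p)) :
  exists2 K : R, 0 < K & forall u, enorm (u *m A) <= K * enorm u.
Proof.
exists (p%:R * (n%:R * `|A|) + 1) => [|u].
  by rewrite ltr_pwDr// !mulr_ge0.
apply: (le_trans (enorm_le_norm _)).
rewrite mulrDl mul1r ler_wpDr ?enorm_ge0// -!mulrA ler_wpM2l//.
apply: norm_le_coord => [|j]; first by rewrite !mulr_ge0 ?enorm_ge0.
rewrite mxE (le_trans (ler_norm_sum _ _ _))//.
apply: (@le_trans _ _ (\sum_(i < n) `|A| * enorm u)); last first.
  by rewrite sumr_const card_ord -[leLHS]mulr_natl.
apply: ler_sum => i _; rewrite normrM mulrC ler_pM ?coord_le_norm//.
exact: le_trans (coord_le_norm _ _ _) (norm_le_enorm _).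
Qed.

(** * Orthonormal bases, singular values and least squares *)

(** Gram-Schmidt by induction on the rank: split off a unit vector e of the row
    space and project the rows of V onto the orthogonal complement of e. *)
Lemma orthonormal_basis (R : realType) n r p (V : 'M[R]_(p, n)) :
  \rank V = r -> exists2 B : 'M[R]_(r, n), B *m B^T = 1%:M & (B :=: V)%MS.
Proof.
elim: r p V => [|r IHr] p V rV.
  have V0 : V = 0 by apply/eqP; rewrite -mxrank_eq0 rV.
  exists 0; first by apply/matrixP => -[].
  by rewrite V0; apply/eqmxP; rewrite !sub0mx.
set v := nz_row V.
have v0 : v != 0 by rewrite nz_row_eq0 -mxrank_eq0 rV.
have vp : 0 < enorm v.
  by rewrite lt0r enorm_ge0 andbT; apply: contra_neq v0 => /enorm_eq0.
pose e := (enorm v)^-1 *: v.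
have ee : e *m e^T = 1%:M.
  rewrite [LHS]mx11_scalar -[_ 0 0]/(dot e e) dotZl dotZr -sqr_enorm.
  by congr _%:M; rewrite mulrA -expr2 -exprMn mulVf ?expr1n ?gt_eqF.
have eV : (e <= V)%MS by rewrite scalemx_sub// nz_row_sub.
pose W := V - V *m e^T *m e.
have We : W *m e^T = 0 by rewrite mulmxBl -!mulmxA ee mulmx1 subrr.
have WV : (W <= V)%MS.
  by rewrite addmx_sub// -scaleN1r scalemx_sub// (submx_trans _ eV)// submxMl.
have eWV : (e + W :=: V)%MS.
  apply/eqmxP; rewrite addsmx_sub eV WV/=.
  have -> : V = V *m e^T *m e + W by rewrite addrC subrK.
  by rewrite addmx_sub_adds// submxMl.
have eW0 : (e :&: W)%MS = 0.
  apply/eqP; rewrite -submx0; apply/rV_subP => u; rewrite sub_capmx => /andP[].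
  move=> /submxP[a ->] /submxP[b] ab; rewrite submx0.
  have := congr1 (fun x => x *m e^T) ab.
  by rewrite -!mulmxA We ee mulmx1 mulmx0 => ->; rewrite mul0mx.
have rW : \rank W = r.
  have rVE : \rank V = \rank (e + W)%MS by rewrite eWV.
  apply/eqP; rewrite -eqSS -rV rVE (mxrank_disjoint_sum eW0).
  by rewrite rank_rV scaler_eq0 negb_or invr_eq0 (gt_eqF vp) v0.
have [B BB BW] := IHr _ _ rW.
have Be : B *m e^T = 0.
  have /submxP[D ->] : (B <= W)%MS by rewrite BW.
  by rewrite -mulmxA We mulmx0.
have [BB1 BB2] : col_mx e B *m (col_mx e B)^T = 1%:M /\ (col_mx e B :=: V)%MS;
  last by exists (col_mx e B).
split.
  rewrite tr_col_mx mul_col_row ee BB Be (_ : e *m B^T = 0).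
    by rewrite (scalar_mx_block 1 r).
  by rewrite -[e *m _]trmxK trmx_mul trmxK Be trmx0.
apply: eqmx_trans eWV; apply: eqmx_trans (eqmx_sym (addsmxE _ _)) _.
exact: adds_eqmx.
Qed.

Lemma char_poly_conj (F : fieldType) n (P D : 'M[F]_n) : P \in unitmx ->
  char_poly (invmx P *m D *m P) = char_poly D.
Proof.
move=> Pu; rewrite /char_poly /char_poly_mx.
set p := map_mx polyC.
have pVp : p (invmx P) *m p P = 1%:M by rewrite -map_mxM mulVmx// map_mx1.
have -> : 'X%:M - p (invmx P *m D *m P) = p (invmx P) *m ('X%:M - p D) *m p P.
  rewrite mulmxBr mulmxBl -!map_mxM; congr (_ - _).
  by rewrite scalar_mxC -mulmxA pVp mulmx1.
by rewrite !det_mulmx mulrAC -det_mulmx pVp det1 mul1r.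
Qed.

(** Over the complex numbers this is the spectral theorem for Hermitian matrices;
    the eigenvalues are real, so the factorization descends to the real field. *)
Lemma symmetric_char_poly_split (R : realType) n (A : 'M[R]_n) :
  A^T = A -> exists d : 'rV[R]_n, char_poly A = \prod_i ('X - (d 0 i)%:P).
Proof.
move=> AT; pose toC := complex.real_complex R.
pose AC := map_mx toC A.
have AC_real : AC \is a realmx.
  by apply/mxOverP => i j; rewrite mxE; apply/complex.complex_realP; exists (A i j).
have AC_sym : AC \is symmetricmx.
  by apply/is_hermitianmxP; rewrite expr0 scale1r map_mx_id// /AC map_trmx AT.
have AC_herm := realsym_hermsym AC_sym AC_real.
have /orthomx_spectralP AE := hermitian_normalmx AC_herm.
have dR := hermitian_spectral_diag_real AC_herm.
pose d := map_mx (@complex.Re R) (spectral_diag AC).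
exists d; apply: (@map_poly_inj _ _ toC).
rewrite map_char_poly -/AC AE.
rewrite rmorph_prod/=.
have dE i : toC (d 0 i) = spectral_diag AC 0 i.
  by rewrite mxE; apply: complex.RRe_real; exact: (mxOverP dR).
rewrite char_poly_conj ?spectral_unit// char_poly_trig ?diag_mx_is_trig//.
apply: eq_bigr => i _; rewrite mxE eqxx mulr1n -dE.
by rewrite map_polyXsubC.
Qed.

Lemma eigenvalue_gram (R : realType) m n (A : 'M[R]_(m, n)) (a : R) :
  root (char_poly (A *m A^T)) a ->
  0 <= a /\ (row_free A -> a != 0).
Proof.
rewrite -eigenvalue_root_char => /eigenvalueP[v vA v0].
have vAvA : dot (v *m A) (v *m A) = a * dot v v.
  by rewrite -dotZl -vA mulmxA dot_mulmxl dotC.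
have vv : 0 < dot v v.
  by rewrite lt0r dot_ge0 andbT; apply: contra_neq v0 => /dot_eq0.
split; first by rewrite -(pmulr_lge0 _ vv) -vAvA dot_ge0.
move=> /row_freeP[B AB]; apply: contra_neq v0 => a0.
move: vAvA; rewrite a0 mul0r => /dot_eq0 vA0.
by rewrite -[v]mulmx1 -AB mulmxA vA0 mul0mx.
Qed.

(** The squares of the singular values are the eigenvalues of the symmetric
    matrix A A^T, so they exist because a real symmetric matrix has a split
    characteristic polynomial. *)
Lemma singular_valuesP (R : realType) m n (A : 'M[R]_(m, n)) :
  [/\ sorted >=%R (singular_values A), all (fun a => 0 <= a) (singular_values A) &
    char_poly (A *m A^T) =
      \prod_(a <- singular_values A) ('X - (a ^+ 2)%:P)].
Proof.
rewrite /singular_values; case: xgetP => [s _ //|].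
have [d dE] : exists d : 'rV[R]_m,
    char_poly (A *m A^T) = \prod_i ('X - (d 0 i)%:P).
  by apply: symmetric_char_poly_split; rewrite trmx_mul trmxK.
have d0 i : 0 <= d 0 i.
  have [//|//] := @eigenvalue_gram _ _ _ A (d 0 i) _.
  by rewrite dE /root horner_prod (bigD1 i)//= hornerXsubC subrr mul0r.
pose s := sort >=%R [seq Num.sqrt (d 0 i) | i <- enum 'I_m].
move=> /(_ s)[]; split.
- by apply: sort_sorted => x y; exact: le_total.
- by rewrite all_sort all_map; apply/allP => i _; exact: sqrtr_ge0.
- rewrite (perm_big _ (permEl (perm_sort _ _)))/= big_map dE big_enum/=.
  by apply: eq_bigr => i _; rewrite sqr_sqrtr.
Qed.

(** The row space of A has full dimension m, so that A A^T has no zero eigenvalue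
    and the m-th singular value is the last entry of the list. *)
Lemma singular_value_gt0 (R : realType) m n (A : 'M[R]_(m, n)) : (0 < m)%N ->
  row_free A -> 0 < singular_value m A.
Proof.
move=> m0 Afree; have [_ s_ge0 s_char] := singular_valuesP A.
have s_size : size (singular_values A) = m.
  by apply: succn_inj; rewrite -(size_char_poly (A *m A^T)) s_char size_prod_XsubC.
have s_in : singular_value m A \in singular_values A.
  by apply: mem_nth; rewrite s_size prednK.
rewrite lt0r (allP s_ge0)// andbT.
suff : singular_value m A ^+ 2 != 0 by rewrite sqrf_eq0.
have [//|_ /(_ Afree)//] := @eigenvalue_gram _ _ _ A (singular_value m A ^+ 2) _.
rewrite s_char /root horner_prod prodf_seq_eq0; apply/hasP.
by exists (singular_value m A) => //=; rewrite hornerXsubC subrr.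
Qed.

(** Stability of linear least squares. The residual is orthogonal to the range of
    A; testing this against the image of the error y itself leaves the square of
    the norm of y A on one side and only Fs, which is almost orthogonal to the
    range of A, and rho on the other. *)
Lemma pinv_inj_estimate (R : realType) m n (A : 'M[R]_(m, n)) (sigma : R)
    (w : 'rV[R]_m) (Fs rho : 'rV[R]_n) (delta : R) :
  0 < sigma -> 0 <= delta -> (forall y, sigma * enorm y <= enorm (y *m A)) ->
  (forall y, `|dot Fs (y *m A)| <= delta * enorm y) ->
  enorm (- ((Fs - w *m A + rho) *m pinv_inj A) - w) <=
    delta / sigma ^+ 2 + enorm rho / sigma.
Proof.
move=> s0 d0 Asig Fsd.
have Afree : row_free A.
  apply: inj_row_free => v vA0; apply: enorm_eq0; apply/eqP.
  rewrite eq_le enorm_ge0 andbT -(pmulr_rle0 _ s0) (le_trans (Asig v))//.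
  by rewrite vA0 enorm0.
have AATu : A *m A^T \in unitmx.
  rewrite -row_free_unit; apply: inj_row_free => v vA0.
  have : dot (v *m A) (v *m A) = 0.
    by rewrite dot_mulmxl -mulmxA vA0 dotC /dot mul0mx mxE.
  move=> /dot_eq0 vA; have [B AB] := row_freeP Afree.
  by rewrite -[v]mulmx1 -AB mulmxA vA mul0mx.
set y := (- _ - w).
have yA : y *m (A *m A^T) = - ((Fs + rho) *m A^T).
  rewrite mulmxBl mulNmx.
  have -> F : F *m pinv_inj A *m (A *m A^T) = F *m A^T.
    by rewrite /pinv_inj -!mulmxA mulVmx ?mulmx1.
  by rewrite -opprD !mulmxDl mulNmx mulmxA addrAC subrK.
have nn : enorm (y *m A) ^+ 2 <= (delta / sigma + enorm rho) * enorm (y *m A).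
  rewrite sqr_enorm dot_mulmxl -mulmxA yA dotNr -dot_mulmxl dotDr opprD.
  rewrite mulrDl lerD//.
    rewrite dotC (le_trans (ler_norm _))// normrN (le_trans (Fsd y))//.
    by rewrite -mulrA ler_wpM2l// ler_pdivlMl.
  by rewrite dotC -dotNl (le_trans (Cauchy_Schwarz _ _))// enormN.
have n_le : enorm (y *m A) <= delta / sigma + enorm rho.
  have [n0|n0] := eqVneq (enorm (y *m A)) 0.
    by rewrite n0 addr_ge0 ?enorm_ge0 ?divr_ge0// ltW.
  by rewrite -(@ler_pM2r _ (enorm (y *m A))) ?lt0r ?n0 ?enorm_ge0// -expr2.
have -> : delta / sigma ^+ 2 + enorm rho / sigma =
          (delta / sigma + enorm rho) / sigma.
  by rewrite mulrDl expr2 invfM mulrA.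
by rewrite ler_pdivlMr// mulrC (le_trans (Asig y)).
Qed.

(** * Mean value estimates for maps of class C^1 and C^2 *)

Lemma differentiable_near_eq (R : numFieldType) (V W : normedModType R)
    (f g : V -> W) (x : V) :
  (\forall y \near x, f y = g y) -> differentiable f x -> differentiable g x.
Proof.
move=> fg df.
have go : g \o shift x = cst (g x) + 'd f x +o_ 0 id.
  apply/eqaddoP => e e0.
  have /eqaddoP/(_ e e0) := diff_locally df.
  have : \forall h \near (0 : V), f (h + x) = g (h + x).
    by move: fg; rewrite (near_shift 0)/=; apply: filterS => h; rewrite subr0.
  apply: filterS2 => h; rewrite !fctE /= => ->.
  by rewrite (nbhs_singleton fg).
have dgE := diff_unique (diff_continuous df) go.
by apply/diff_locallyP; rewrite dgE; split=> //; exact: diff_continuous df.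
Qed.

Lemma is_derive_curve (R : numFieldType) (V W : normedModType R)
    (f : V -> W) (g : R -> V) (t : R) (x v : V) : g t = x ->
  is_derive t 1 g v -> differentiable f x ->
  is_derive t 1 (f \o g) ('d f x v).
Proof.
move=> <- [gt gv] ft.
have dg : differentiable g t by apply/derivable1_diffP.
have dfg : differentiable (f \o g) t by exact: differentiable_comp.
apply: DeriveDef; first exact/derivable1_diffP.
by rewrite deriveE// diff_comp//= -gv deriveE.
Qed.

Lemma is_derive_line (R : numFieldType) (V : normedModType R) (x v : V) (t : R) :
  is_derive t 1 (fun s : R => x + s *: v) v.
Proof.
have dZ : is_diff t ( *:%R^~ v : R -> V) ( *:%R^~ v) by exact: is_diff_scalel.
have Zv : is_derive t 1 ( *:%R^~ v : R -> V) v.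
  apply: DeriveDef; first exact/derivable1_diffP.
  by rewrite deriveE// diff_val scale1r.
by have := is_deriveD (is_derive_cst x t 1) Zv; rewrite add0r.
Qed.

Lemma coord_is_derive (R : realFieldType) p (f : R -> 'rV[R]_p) (t : R) w j :
  is_derive t 1 f w -> is_derive t 1 (fun s => f s 0 j) (w 0 j).
Proof.
move=> [df dfw]; apply: DeriveDef; first exact: (derivable_mxP _ _ _).1 df 0 j.
by rewrite -dfw derive_mx// mxE.
Qed.

(** The mean value theorem holds for each coordinate, with intermediate points
    that depend on the coordinate; the maximum norm is blind to this. *)
Lemma mean_value_le (R : realType) (V : normedModType R) p (f : V -> 'rV[R]_p)
    (x y : V) (w : 'rV[R]_p) (K : R) :
  (forall t : R, 0 <= t <= 1 -> differentiable f (x + t *: (y - x))) ->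
  (forall t : R, 0 <= t <= 1 -> `|'d f (x + t *: (y - x)) (y - x) - w| <= K) ->
  `|f y - f x - w| <= K.
Proof.
move=> fd fK.
have K0 : 0 <= K by apply: le_trans (fK 0 _) => //; rewrite lexx ler01.
apply: norm_le_coord => // j.
pose g (t : R) : R := f (x + t *: (y - x)) 0 j.
pose dg (t : R) : R := 'd f (x + t *: (y - x)) (y - x) 0 j.
have gd (t : R) : 0 <= t <= 1 -> is_derive t 1 g (dg t).
  move=> t01; apply: coord_is_derive.
  apply: (@is_derive_curve _ _ _ f (fun s : R => x + s *: (y - x))) => //.
    exact: is_derive_line.
  exact: fd.
have [||c c01] := @MVT_segment R g dg 0 1 ler01.
- by move=> t; rewrite in_itv/= => /andP[t0 t1]; apply: gd; rewrite !ltW.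
- apply: derivable_within_continuous => t; rewrite in_itv/= => t01.
  by have [] := gd t t01.
rewrite subr0 mulr1 /g scale1r scale0r addr0 (addrC x) subrK => fE.
rewrite !mxE fE.
apply: le_trans (fK c _); last by move: c01; rewrite in_itv.
by rewrite (le_trans _ (coord_le_norm _ 0 j))// !mxE.
Qed.

Lemma class_C_eq (R : realType) (V W : normedModType R) k (O : set V)
    (f g : V -> W) : open O -> (forall x, O x -> f x = g x) ->
  class_C k O f -> class_C k O g.
Proof.
move=> Oo; have On x : O x -> nbhs x O by move=> Ox; exact: open_nbhs_nbhs.
elim: k f g => [|k IHk] f g fg /=.
  move=> fc x Ox; rewrite /prop_for /continuous_at -(fg x Ox).
  apply: cvg_trans (fc x Ox); apply: near_eq_cvg.
  by apply: filterS (On x Ox) => y /fg.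
move=> [fd fD]; split=> [x Ox|v].
  by apply: differentiable_near_eq (fd x Ox); exact: filterS (On x Ox).
apply: IHk (fD v) => x Ox; apply: near_eq_derive.
exact: filterS (On x Ox).
Qed.

(** Precomposition with a map whose differential does not depend on the point
    turns directional derivatives into directional derivatives, so that it
    preserves the class. It covers both straight lines and the splitting of a
    vector of dimension n + p into a pair. *)
Lemma class_C_comp_affine (R : realType) (V' V W : normedModType R) k
    (O : set V) (f : V -> W) (g L : V' -> V) :
  (forall t, is_diff t g L) -> open O -> class_C k O f ->
  class_C k (g @^-1` O) (f \o g).
Proof.
move=> gL Oo.
have gd t : differentiable g t by have [] := gL t.
have gE t v : 'd g t v = L v by have [_ ->] := gL t.
have gc : continuous g by move=> t; exact: differentiable_continuous.
have O'o : open (g @^-1` O) by apply: open_comp => // x _; exact: gc.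
elim: k f => [|k IHk] f /=.
  by move=> fc t Ot; apply: continuous_comp; [exact: gc|exact: fc].
move=> [fd fD]; split=> [t Ot|v].
  by apply: differentiable_comp => //; exact: fd.
apply: class_C_eq (IHk _ (fD (L v))) => // t Ot.
rewrite [RHS]deriveE; last by apply: differentiable_comp => //; exact: fd.
by rewrite diff_comp//= ?gE ?deriveE//; exact: fd.
Qed.

(** A function of class C^1 has a differential that is locally bounded: in the
    canonical basis its entries are the directional derivatives, which are
    continuous. *)
Lemma C1_diff_bounded (R : realType) n (W : normedModType R) (O : set 'rV[R]_n)
    (f : 'rV[R]_n -> W) (p : 'rV[R]_n) : open_nbhs p O -> class_C 1 O f ->
  exists2 K : R, 0 <= K &
    \forall x \near p, forall v, `|'d f x v| <= K * `|v|.
Proof.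
move=> pO [fd fD].
pose e j : 'rV[R]_n := delta_mx 0 j.
exists (\sum_j (`|'D_(e j) f p| + 1)).
  by apply: sumr_ge0 => j _; rewrite addr_ge0.
have near_e : \forall x \near p, forall j, `|'D_(e j) f x| < `|'D_(e j) f p| + 1.
  have := @filter_forall _ _ (fun j x => `|'D_(e j) f x| < `|'D_(e j) f p| + 1)
    (nbhs p) _; apply=> j.
  have De : 'D_(e j) f x @[x --> p] --> 'D_(e j) f p := fD (e j) p pO.2.
  by apply: (cvgr_lt _ (cvg_norm De)); rewrite ltrDl.
have near_O : \forall x \near p, O x := open_nbhs_nbhs pO.
apply: filterS2 near_e near_O => x xe Ox v.
rewrite {1}[v]row_sum_delta linear_sum mulr_suml.
apply: (le_trans (ler_norm_sum _ _ _)); apply: ler_sum => j _.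
rewrite linearZ normrZ mulrC ler_pM ?coord_le_norm//.
by rewrite -deriveE ?ltW// ; exact: fd.
Qed.

Lemma near_norm (R : realType) (V : normedModType R) (p : V) (P : set V) :
  (\forall x \near p, P x) <->
  exists2 r : R, 0 < r & forall x, `|x - p| < r -> P x.
Proof.
split=> [/nbhs_ballP[r r0 rP]|[r r0 rP]].
  by exists r => // x xr; apply: rP; rewrite -ball_normE /ball_/= distrC.
apply/nbhs_ballP; exists r => // x; rewrite -ball_normE /ball_/= distrC.
exact: rP.
Qed.

Lemma segment_ball (R : realType) (V : normedModType R) (p x y : V) (r t : R) :
  `|x - p| < r -> `|y - p| < r -> 0 <= t <= 1 ->
  `|x + t *: (y - x) - p| < r.
Proof.
move=> xr yr /andP[t0 t1].
have -> : x + t *: (y - x) - p = (1 - t) *: (x - p) + t *: (y - p).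
  rewrite scalerBl scale1r -[RHS]addrA [X in _ = _ + X]addrC -scalerBr.
  by rewrite opprB addrA subrK addrAC.
apply: (le_lt_trans (ler_normD _ _)); rewrite !normrZ ger0_norm ?subr_ge0//.
rewrite (ger0_norm t0).
have [->|tp] := eqVneq t 0; first by rewrite subr0 mul1r mul0r addr0.
have t0' : 0 < t by rewrite lt0r tp.
have : t * `|y - p| < t * r by rewrite ltr_pM2l.
have : (1 - t) * `|x - p| <= (1 - t) * r by rewrite ler_wpM2l ?subr_ge0// ltW.
lra.
Qed.

Lemma C1_lipschitz (R : realType) n p (O : set 'rV[R]_n)
    (f : 'rV[R]_n -> 'rV[R]_p) (a : 'rV[R]_n) :
  open_nbhs a O -> class_C 1 O f ->
  exists2 K : R, 0 <= K & exists2 r : R, 0 < r &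
    forall x y, `|x - a| < r -> `|y - a| < r -> `|f y - f x| <= K * `|y - x|.
Proof.
move=> aO fC; have [K K0 fK] := C1_diff_bounded aO fC.
have [r r0 rP] : exists2 r : R, 0 < r & forall x, `|x - a| < r ->
    O x /\ forall v, `|'d f x v| <= K * `|v|.
  by apply/near_norm; apply: filterS2 (open_nbhs_nbhs aO) fK.
exists K => //; exists r => // x y xr yr; rewrite -[f y - f x]subr0.
apply: mean_value_le => t t01.
  by apply: fC.1; apply: (rP _ _).1; exact: segment_ball.
by rewrite subr0; apply: (rP _ _).2; exact: segment_ball.
Qed.

(** Near a point, a function of class C^2 has a bounded and Lipschitz
    differential, which gives a first-order Taylor formula whose quadratic
    remainder is uniform in the base point. *)
Lemma C2_estimates (R : realType) n p (O : set 'rV[R]_n)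
    (f : 'rV[R]_n -> 'rV[R]_p) (a : 'rV[R]_n) :
  open_nbhs a O -> class_C 2 O f ->
  exists2 K : R, 0 <= K & exists2 r : R, 0 < r &
    forall x, `|x - a| < r ->
    [/\ O x, forall v, `|'d f x v| <= K * `|v| &
    forall y, `|y - a| < r ->
    [/\ `|f y - f x| <= K * `|y - x|,
        forall v, `|'d f y v - 'd f x v| <= K * `|y - x| * `|v| &
        `|f y - f x - 'd f x (y - x)| <= K * `|y - x| ^+ 2]].
Proof.
move=> aO fC2.
have fC1 : class_C 1 O f.
  split=> [|v]; first exact: fC2.1.
  by move=> x Ox; apply: differentiable_continuous; exact: (fC2.2 v).1.
have [K1 K10 [r1 r10 fK1]] := C1_lipschitz aO fC1.
have [K2 K20 fK2] := C1_diff_bounded aO fC1.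
have [r2 r20 rP] : exists2 r : R, 0 < r & forall x, `|x - a| < r ->
    O x /\ forall v, `|'d f x v| <= K2 * `|v|.
  by apply/near_norm; apply: filterS2 (open_nbhs_nbhs aO) fK2.
pose e j : 'rV[R]_n := delta_mx 0 j.
have /choice[KD KDP] : forall j, exists K : R, 0 <= K /\ exists2 r : R, 0 < r &
    forall x y, `|x - a| < r -> `|y - a| < r ->
      `|'D_(e j) f y - 'D_(e j) f x| <= K * `|y - x|.
  by move=> j; have [K ? ?] := C1_lipschitz aO (fC2.2 (e j)); exists K.
have [r3 r30 rD] : exists2 r : R, 0 < r & forall x, `|x - a| < r ->
    forall j, forall y, `|y - a| < r ->
      `|'D_(e j) f y - 'D_(e j) f x| <= KD j * `|y - x|.
  have /choice[rr rrP] : forall j, exists r : R, 0 < r /\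
    forall x y, `|x - a| < r -> `|y - a| < r ->
      `|'D_(e j) f y - 'D_(e j) f x| <= KD j * `|y - x|.
    by move=> j; have [_ [r ? ?]] := KDP j; exists r.
  exists (\big[Order.min/1]_j rr j).
    by apply: lt_bigmin => // j _; have [] := rrP j.
  move=> x xr j y yr; apply: (rrP j).2.
  - by apply: lt_le_trans xr _; exact: bigmin_le.
  - by apply: lt_le_trans yr _; exact: bigmin_le.
pose K3 := \sum_j KD j.
have K30 : 0 <= K3 by apply: sumr_ge0 => j _; have [] := KDP j.
pose r := Num.min r1 (Num.min r2 r3).
have rr x : `|x - a| < r -> [/\ `|x - a| < r1, `|x - a| < r2 & `|x - a| < r3].
  by rewrite /r !lt_min => /and3P[].
have lipD x y v : `|x - a| < r -> `|y - a| < r ->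
    `|'d f y v - 'd f x v| <= K3 * `|y - x| * `|v|.
  move=> /rr[_ x2 x3] /rr[_ y2 y3].
  have dE z : O z -> 'd f z v = \sum_j v 0 j *: 'D_(e j) f z.
    move=> Oz; rewrite {1}[v]row_sum_delta linear_sum; apply: eq_bigr => j _.
    by rewrite linearZ deriveE//; exact: fC2.1.
  have -> : 'd f y v - 'd f x v =
      \sum_j v 0 j *: ('D_(e j) f y - 'D_(e j) f x).
    under eq_bigr do rewrite scalerBr; rewrite sumrB.
    by congr (_ - _); [exact: dE (rP _ y2).1|exact: dE (rP _ x2).1].
  rewrite !mulr_suml.
  apply: (le_trans (ler_norm_sum _ _ _)); apply: ler_sum => j _.
  rewrite normrZ mulrC ler_pM ?coord_le_norm//.
  exact: rD.
exists (K1 + K2 + K3); first by rewrite !addr_ge0.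
exists r; first by rewrite !lt_min r10 r20.
move=> x xr; have [x1 x2 x3] := rr x xr; have [Ox xK2] := rP x x2.
split=> // [v|y yr].
  apply: (le_trans (xK2 v)); rewrite ler_wpM2r//; lra.
have [y1 y2 y3] := rr y yr.
split=> [|v|].
- by apply: (le_trans (fK1 _ _ x1 y1)); rewrite ler_wpM2r//; lra.
- apply: (le_trans (lipD _ _ v xr yr)); rewrite -!mulrA ler_wpM2r ?mulr_ge0//; lra.
- apply: mean_value_le => t t01.
    by apply/fC2.1/(rP _ _).1; exact: segment_ball.
  apply: (le_trans (lipD x _ _ xr _)); first exact: segment_ball.
  rewrite expr2 !mulrA ler_wpM2r// (addrC x) addrK normrZ mulrA ler_wpM2r//.
  case/andP: t01 => t0 t1; rewrite (ger0_norm t0).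
  have := ler_piMr K30 t1; lra.
Qed.

(** * Tangent spaces in a chart *)

Lemma linear_perturbation (R : realType) (V W : normedModType R)
    (D D' : {linear V -> W}) (K Kc a : R) (y y' : V) : 0 <= K ->
  (forall v, `|D v - D' v| <= K * a * `|v|) -> (forall v, `|D' v| <= K * `|v|) ->
  `|y - y'| <= Kc * a * `|y| -> `|D y - D' y'| <= (K + K * Kc) * a * `|y|.
Proof.
move=> K0 DD' D'K yy'.
have -> : D y - D' y' = (D y - D' y) + D' (y - y') by rewrite linearB addrA subrK.
rewrite !mulrDl (le_trans (ler_normD _ _))// lerD// (le_trans (D'K _))//.
by rewrite -!mulrA ler_wpM2l// mulrA.
Qed.

Section Chart.
Variables (R : realType) (M m : nat) (S O W : set 'rV[R]_M).
Variables (Phi Psi : 'rV[R]_M -> 'rV[R]_M).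
Hypotheses (m_leM : (m <= M)%N) (O_open : open O) (W_open : open W).
Hypotheses (Phi_smooth : smooth O Phi) (Psi_smooth : smooth W Psi).
Hypotheses (Phi_im : Phi @` O = W) (PhiK : forall x, O x -> Psi (Phi x) = x).

Definition flat (z : 'rV[R]_M) := forall i : 'I_M, (m <= i)%N -> z 0 i = 0.

Hypothesis S_flat : forall x, O x -> (S x <-> flat (Phi x)).

Let W_Phi x : O x -> W (Phi x).
Proof. by move=> Ox; rewrite -Phi_im; exists x. Qed.

Let O_Psi y : W y -> O (Psi y).
Proof. by rewrite -Phi_im => -[x Ox <-]; rewrite PhiK. Qed.

Let PsiK y : W y -> Phi (Psi y) = y.
Proof. by rewrite -Phi_im => -[x Ox <-]; rewrite PhiK. Qed.

Let dPhi x : O x -> differentiable Phi x.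
Proof. exact: (Phi_smooth 1%N).1. Qed.

Let dPsi y : W y -> differentiable Psi y.
Proof. exact: (Psi_smooth 1%N).1. Qed.

Lemma diff_local_inverse (V : normedModType R) (f g : V -> V) (A : set V) x y :
  open_nbhs x A -> (forall y, A y -> g (f y) = y) ->
  f x = y -> differentiable f x -> differentiable g y ->
  forall v, 'd g y ('d f x v) = v.
Proof.
move=> Ax fK <- df dg v.
have <- : 'd (g \o f) x v = 'd g (f x) ('d f x v) by rewrite diff_comp.
rewrite -deriveE; last exact: differentiable_comp.
rewrite (@near_eq_derive _ _ _ (g \o f) id); first by rewrite derive_id.
by apply: filterS (open_nbhs_nbhs Ax) => z /fK.
Qed.

Let dPhiK x v : O x -> 'd Psi (Phi x) ('d Phi x v) = v.
Proof.
move=> Ox; apply: (@diff_local_inverse _ _ _ O) => //.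
  exact: dPhi.
exact/dPsi/W_Phi.
Qed.

Let dPsiK x z : O x -> 'd Phi x ('d Psi (Phi x) z) = z.
Proof.
move=> Ox; apply: (@diff_local_inverse _ _ _ W) => //.
- by split=> //; exact: W_Phi.
- exact: PhiK.
- exact/dPsi/W_Phi.
- exact: dPhi.
Qed.

(** A curve in S has a flat image under Phi, hence a flat velocity there;
    conversely a flat direction is the velocity of a straight segment, which Psi
    maps back to a curve in S. *)
Lemma chart_tangent x v : O x -> S x ->
  tangent_space S x v <-> flat ('d Phi x v).
Proof.
move=> Ox Sx; split=> [[g [A [A_open A0] [g_smooth gS g0 gv]]]|dv_flat].
  have gd : differentiable g 0 by exact: (g_smooth 1%N).1.
  have PhigE : is_derive (0 : R) 1 (Phi \o g) ('d Phi x v).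
    by apply: is_derive_curve => //; exact: dPhi.
  have nearO : \forall t \near (0 : R), O (g t).
    apply: differentiable_continuous gd _ _.
    by apply: open_nbhs_nbhs; split=> //; rewrite g0.
  have nearA : \forall t \near (0 : R), A t by exact: open_nbhs_nbhs.
  move=> i mi; have Phigi := coord_is_derive i PhigE.
  have : is_derive (0 : R) 1 (cst 0 : R -> R) ('d Phi x v 0 i).
    apply: near_eq_is_derive Phigi; apply: filterS2 nearO nearA => t Ot At.
    by rewrite /= (S_flat Ot).1//; exact: gS.
  by move=> [_ <-]; rewrite derive_cst.
pose z := 'd Phi x v.
pose g (t : R) := Psi (Phi x + t *: z).
exists g; exists [set t : R | W (Phi x + t *: z)].
  split; last by rewrite /= scale0r addr0; exact: W_Phi.
  apply: (@open_comp _ _ (fun t : R => Phi x + t *: z) W) => // t _.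
  apply: differentiable_continuous; apply/derivable1_diffP.
  by have [] := is_derive_line (Phi x) z t.
split=> [k|t Wt||].
- have gz (s : R^o) : is_diff s (fun t : R^o => Phi x + t *: z) ( *:%R^~ z).
    have := @is_diff_scalel _ _ s z.
    move=> /(@is_diffD _ _ _ _ _ _ _ s (is_diff_cst (Phi x) s)).
    by rewrite add0r.
  have h := class_C_comp_affine gz W_open (Psi_smooth k).
  exact: h.
- apply/S_flat; first exact: O_Psi.
  rewrite PsiK// => i mi; rewrite !mxE dv_flat// mulr0 addr0.
  exact: (S_flat Ox).1.
- by rewrite /g scale0r addr0 PhiK.
- rewrite -[v](dPhiK _ Ox); 
  apply: (@is_derive_curve _ _ _ Psi (fun t : R => Phi x + t *: z)).
  + by rewrite scale0r addr0.
  + exact: is_derive_line.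
  + exact/dPsi/W_Phi.
Qed.

Lemma flat_pid_mx z : flat z -> z *m pid_mx m = z.
Proof.
move=> zf; apply/rowP => j; rewrite mxE (bigD1 j)//= !mxE eqxx/=.
rewrite big1 => [|i ij]; last by rewrite mxE val_eqE (negbTE ij)/= mulr0.
rewrite addr0; case: (ltnP j m) => [_|mj]; first by rewrite mulr1.
by rewrite mulr0 zf.
Qed.

Lemma pid_mx_flat z : flat (z *m (pid_mx m : 'M[R]_M)).
Proof.
move=> i mi; rewrite mxE big1// => j _; rewrite mxE.
case: eqP => [->|_]; last by rewrite mulr0.
by rewrite ltnNge mi mulr0.
Qed.

(** In the chart, the tangent space is the row space of pid_mx m times the
    invertible Jacobian of Psi, so it is linear of dimension m and has an
    orthonormal basis for tangent_onb to choose. *)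
Lemma tangent_onbP x : O x -> S x ->
  tangent_onb S m x *m (tangent_onb S m x)^T = 1%:M /\
  forall v, tangent_space S x v <-> (v <= tangent_onb S m x)%MS.
Proof.
move=> Ox Sx; pose J := lin1_mx ('d Psi (Phi x)).
pose V := (pid_mx m : 'M[R]_M) *m J.
have VP v : tangent_space S x v <-> (v <= V)%MS.
  rewrite chart_tangent//; split=> [vf|/submxP[u ->]].
    apply/submxP; exists ('d Phi x v).
    by rewrite /V mulmxA flat_pid_mx// mul_rV_lin1/= dPhiK.
  by rewrite /V mulmxA mul_rV_lin1/= dPsiK//; exact: pid_mx_flat.
have rV : \rank V = m.
  rewrite mxrankMfree ?rank_pid_mx// /row_free; apply: inj_row_free => z.
  have zE : 'd Phi x (z *m J) = z by rewrite mul_rV_lin1; exact: dPsiK.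
  by move=> z0; rewrite -zE z0; exact: linear0.
have [B BB BV] := orthonormal_basis rV.
suff : exists B : 'M[R]_(m, M), B *m B^T = 1%:M /\
    forall v, tangent_space S x v <-> (v <= B)%MS by exact: getPex.
by exists B; split=> // v; rewrite VP BV.
Qed.

(** Seen in the chart, secants of S are flat and all tangent spaces are the same
    space of flat vectors; going back by Psi costs a second-order Taylor remainder
    for the secant and the Lipschitz constant of the differential of Psi for the
    tangent vectors. This is what the curvature of S contributes to the error of a
    Gauss-Newton step. *)
Lemma tangent_estimates N (OF : set 'rV[R]_M) (Fe : 'rV[R]_M -> 'rV[R]_N) xs :
  O xs -> S xs -> open_nbhs xs OF -> smooth OF Fe ->
  exists2 K : R, 0 <= K & \forall x \near xs, S x ->
  [/\ O x, OF x,
  exists2 w, tangent_space S x w &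
    enorm (xs - x - w) <= K * enorm (x - xs) ^+ 2 /\
    enorm (Fe xs - Fe x - 'd Fe x w) <= K * enorm (x - xs) ^+ 2 &
  forall y, tangent_space S x y -> exists2 y', tangent_space S xs y' &
    enorm (y - y') <= K * enorm (x - xs) * enorm y /\
    enorm ('d Fe x y - 'd Fe xs y') <= K * enorm (x - xs) * enorm y].
Proof.
move=> Oxs Sxs xsOF Fe_smooth.
have [K1 K10 [r1 r10 PhiE]] :=
  C2_estimates (conj O_open Oxs) (Phi_smooth 2%N).
have [K2 K20 [r2 r20 PsiE]] :=
  C2_estimates (conj W_open (W_Phi Oxs)) (Psi_smooth 2%N).
have [K3 K30 [r3 r30 FeE]] := C2_estimates xsOF (Fe_smooth 2%N).
pose Kc := K2 * K1 ^+ 2.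
have Kc0 : 0 <= Kc by rewrite mulr_ge0 ?exprn_ge0.
pose K0 := Kc + K3 + K3 * Kc.
have K3c : 0 <= K3 * Kc by rewrite mulr_ge0.
have K00 : 0 <= K0 by rewrite /K0; lra.
have Kc_K0 : Kc <= K0 by rewrite /K0; lra.
have K3_K0 : K3 + K3 * Kc <= K0 by rewrite /K0; lra.
have to_enorm p (u : 'rV[R]_p) b : (p <= M + N)%N -> `|u| <= K0 * b -> 0 <= b ->
    enorm u <= (M + N)%:R * K0 * b.
  move=> pMN ub b0; rewrite (le_trans (enorm_le_norm _))// -mulrA.
  by rewrite ler_pM// ler_nat.
exists ((M + N)%:R * K0); first by rewrite mulr_ge0.
have near_Psi : \forall x \near xs, `|Phi x - Phi xs| < r2.
  have Phi_c : Phi x @[x --> xs] --> Phi xs := differentiable_continuous (dPhi Oxs).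
  exact: cvgr_distC_lt Phi_c _ r20.
have near_1 : \forall x \near xs, `|x - xs| < r1.
  by apply/near_norm; exists r1.
have near_3 : \forall x \near xs, `|x - xs| < r3.
  by apply/near_norm; exists r3.
near=> x; move=> Sx.
have x1 : `|x - xs| < r1 by near: x.
have x2 : `|Phi x - Phi xs| < r2 by near: x.
have x3 : `|x - xs| < r3 by near: x.
have c1 : `|xs - xs| < r1 by rewrite subrr normr0.
have c2 : `|Phi xs - Phi xs| < r2 by rewrite subrr normr0.
have c3 : `|xs - xs| < r3 by rewrite subrr normr0.
have [Ox dPhi_le /(_ _ c1)[Phi_lip _ _]] := PhiE _ x1.
have [_ _ /(_ _ c2)[_ _ Psi_taylor]] := PsiE _ x2.
have [_ _ /(_ _ x2)[_ dPsi_lip _]] := PsiE _ c2.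
have [OFx dFe_le /(_ _ c3)[_ _ Fe_taylor]] := FeE _ x3.
have [_ dFes_le /(_ _ x3)[_ dFe_lip _]] := FeE _ c3.
have aE : `|x - xs| <= enorm (x - xs) := norm_le_enorm _.
set a := `|x - xs| in aE.
have a0 : 0 <= a := normr_ge0 _.
rewrite (distrC xs) -/a in Phi_lip; rewrite (distrC xs) -/a in Fe_taylor.
rewrite -/a in dFe_lip.
have a2E : a ^+ 2 <= enorm (x - xs) ^+ 2 by rewrite ler_pXn2r ?nnegrE ?enorm_ge0.
split=> //.
(* The differential of Psi carries the flat secant of the chart to a tangent
   vector of S. *)
- exists ('d Psi (Phi x) (Phi xs - Phi x)).
    apply/chart_tangent => //; rewrite dPsiK// => i mi.
    by rewrite !mxE (S_flat Oxs).1// (S_flat Ox).1// subr0.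
  set w := 'd Psi (Phi x) (Phi xs - Phi x).
  have wE : `|xs - x - w| <= Kc * a ^+ 2.
    rewrite -{1}(PhiK Oxs) -{1}(PhiK Ox) (le_trans Psi_taylor)//.
    by rewrite /Kc -mulrA ler_wpM2l// -exprMn ler_pXn2r ?nnegrE ?mulr_ge0.
  have dwE : `|Fe xs - Fe x - 'd Fe x w| <= (K3 + K3 * Kc) * a ^+ 2.
    have -> : Fe xs - Fe x - 'd Fe x w =
        (Fe xs - Fe x - 'd Fe x (xs - x)) + 'd Fe x (xs - x - w).
      by rewrite (linearB ('d Fe x) (xs - x) w) addrA subrK.
    rewrite mulrDl; apply: (le_trans (ler_normD _ _)).
    apply: lerD; first exact: Fe_taylor.
    by apply: (le_trans (dFe_le _)); rewrite -mulrA ler_wpM2l.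
  have a20 : 0 <= a ^+ 2 by rewrite sqr_ge0.
  split; apply: to_enorm; rewrite ?leq_addr ?leq_addl ?sqr_ge0//.
  + by apply: (le_trans wE); rewrite ler_pM.
  + by apply: (le_trans dwE); rewrite ler_pM// addr_ge0.
(* Transport y to xs by giving it the same coordinates in the chart. *)
- move=> y yT; exists ('d Psi (Phi xs) ('d Phi x y)).
    by apply/chart_tangent => //; rewrite dPsiK//; exact/(chart_tangent y Ox Sx).
  set y' := 'd Psi (Phi xs) ('d Phi x y).
  have yE : `|y - y'| <= Kc * a * `|y|.
    have -> : y - y' = 'd Psi (Phi x) ('d Phi x y) - y' by rewrite dPhiK.
    apply: (le_trans (dPsi_lip _)).
    rewrite distrC.
    apply: (@le_trans _ _ (K2 * (K1 * a) * (K1 * `|y|))).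
      by rewrite ler_pM ?mulr_ge0// ler_wpM2l.
    by rewrite /Kc le_eqVlt; apply/orP; left; apply/eqP; ring.
  have dyE : `|'d Fe x y - 'd Fe xs y'| <= (K3 + K3 * Kc) * a * `|y|.
    exact: (linear_perturbation K30 dFe_lip dFes_le yE).
  have yn := norm_le_enorm y.
  have ay : a * `|y| <= enorm (x - xs) * enorm y by rewrite ler_pM.
  rewrite -!(mulrA (_ * K0)).
  split; apply: to_enorm; rewrite ?leq_addr ?leq_addl ?mulr_ge0 ?enorm_ge0//.
  + by apply: (le_trans yE); rewrite -mulrA ler_pM ?mulr_ge0.
  + by apply: (le_trans dyE); rewrite -mulrA ler_pM ?mulr_ge0// addr_ge0.
Unshelve. all: by end_near. Qed.

End Chart.

(** * The derivative of a map on a submanifold *)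

Lemma mul_jacobian (R : realType) n p (f : 'rV[R]_n -> 'rV[R]_p) x v :
  v *m 'J f x = 'd f x v.
Proof. exact: mul_rV_lin1. Qed.

Lemma is_derive_dot (R : realType) n (u : R -> 'rV[R]_n) (t : R) w :
  is_derive t 1 u w ->
  is_derive t 1 (fun s => dot (u s) (u s)) (2 * dot (u t) w).
Proof.
move=> uw.
have -> : (fun s => dot (u s) (u s)) = \sum_i (fun s => u s 0 i) ^+ 2.
  by apply/funext => s; rewrite dotE fct_sumE; apply: eq_bigr => i _.
rewrite dotE mulr_sumr; apply: is_derive_sum => i.
have := @is_deriveX _ _ _ 2 t 1 _ (coord_is_derive i uw).
by rewrite /= expr1 /GRing.scale/= mulrA.
Qed.

(** The derivative of F on S, defined by curves, is computed by a local extension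
    Fe to an open set of the ambient space. *)
Section Extension.
Variables (R : realType) (M N : nat) (S : set 'rV[R]_M).
Variables (F Fe : 'rV[R]_M -> 'rV[R]_N) (OF : set 'rV[R]_M).
Hypotheses (OF_open : open OF) (Fe_diff : forall x, OF x -> differentiable Fe x).
Hypothesis FE : forall y, OF y -> S y -> F y = Fe y.

Lemma curve_through_near x v (g : R -> 'rV[R]_M) (P : set 'rV[R]_M) :
  curve_through S x v g -> nbhs x P ->
  \forall t \near (0 : R), [/\ derivable g t 1, S (g t) & P (g t)].
Proof.
move=> [A A0 [g_smooth gS g0 _]] xP.
have gd t : A t -> differentiable g t by exact: (g_smooth 1%N).1.
have gP : \forall t \near (0 : R), P (g t).
  apply: differentiable_continuous (gd _ A0.2) _ _.
  by rewrite g0.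
apply: filterS2 (open_nbhs_nbhs A0) gP => t At Pgt; split=> //.
  by apply/derivable1_diffP; exact: gd.
exact: gS.
Qed.

Lemma curve_through_comp x v g : OF x -> curve_through S x v g ->
  is_derive (0 : R) 1 (F \o g) ('d Fe x v).
Proof.
move=> OFx gxv; have [A A0 [g_smooth gS g0 gv]] := gxv.
apply: (@near_eq_is_derive _ _ _ (Fe \o g)).
  have := curve_through_near gxv (open_nbhs_nbhs (conj OF_open OFx)).
  by apply: filterS => t [_ St OFt]; rewrite /= FE.
by apply: is_derive_curve => //; exact: Fe_diff.
Qed.

(** By the chain rule every curve through x with velocity v gives the value on the
    right, so it is the one that mdiff picks. *)
Lemma mdiffE x v : OF x -> tangent_space S x v -> mdiff S F x v = 'd Fe x v.
Proof.
move=> OFx [g gxv].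
suff : [set w | exists2 g, curve_through S x v g & is_derive (0 : R) 1 (F \o g) w]
    (mdiff S F x v).
  move=> [h hxv [_ <-]]; have [_ <-//] := curve_through_comp OFx hxv.
by apply: (@getPex _ [set w | _]); exists ('d Fe x v); exists g => //;
  exact: curve_through_comp.
Qed.

(** Fermat's rule along the curves of S. *)
Lemma local_min_dot_eq0 x v : OF x ->
  (\forall p \near x, S p -> objective F x <= objective F p) ->
  tangent_space S x v -> dot (F x) ('d Fe x v) = 0.
Proof.
move=> OFx xmin [g gxv].
have [_ _ [_ _ g0 _]] := gxv.
have Sx : S x.
  have [A A0 [_ gS <- _]] := gxv; exact/gS/A0.2.
have nearP : \forall y \near x, OF y /\ (S y -> objective F x <= objective F y).
  by apply: filterS2 (open_nbhs_nbhs (conj OF_open OFx)) xmin.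
have /near_norm[r r0 rP] := curve_through_near gxv nearP.
pose h t := dot (Fe (g t)) (Fe (g t)).
have inr (t : R) : t \in `]-r, r[%R -> `|t - 0| < r.
  by rewrite in_itv/= subr0 ltr_norml.
have hd (t : R) : t \in `]-r, r[%R -> derivable h t 1.
  move=> /inr/rP[gd _ [OFt _]].
  have ug : is_derive t 1 (Fe \o g) ('d Fe (g t) ('D_1 g t)).
    by apply: is_derive_curve => //; exact: Fe_diff.
  by have [] := is_derive_dot ug.
have hmin (t : R) : t \in `]-r, r[%R -> h 0 <= h t.
  move=> /inr/rP[_ St [OFt /(_ St)]].
  rewrite /objective ler_pM2l ?invr_gt0// !sqr_enorm /h g0.
  by rewrite !FE.
have zr : 0 \in `]-r, r[%R by rewrite in_itv/= oppr_lt0 r0.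
have le_r : - r <= r by lra.
have [_ h0] := derive1_at_min le_r hd zr hmin.
have ug0 : is_derive (0 : R) 1 (Fe \o g) ('d Fe x v).
  by have [_ _ [_ _ _ gv]] := gxv; apply: is_derive_curve => //; exact: Fe_diff.
have [_] := is_derive_dot ug0; rewrite -/h h0 /= g0 FE// => /esym/eqP.
by rewrite mulf_eq0 pnatr_eq0/= => /eqP.
Qed.

Lemma mdiff_mxE m x : OF x ->
  (forall i, tangent_space S x (row i (tangent_onb S m x))) ->
  mdiff_mx S m F x = tangent_onb S m x *m 'J Fe x.
Proof.
move=> OFx xT; apply/row_matrixP => i; rewrite rowK mdiffE//.
by rewrite row_mul mul_jacobian.
Qed.

End Extension.

(** * Retractions near the zero section *)

Lemma norm_row_mx_le (R : realType) n p (u : 'rV[R]_n) (v : 'rV[R]_p) :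
  `|row_mx u v| <= Num.max `|u| `|v|.
Proof.
apply: norm_le_coord => [|j]; first by rewrite le_max normr_ge0.
rewrite le_max; case: (split_ordP j) => k ->; rewrite ?row_mxEl ?row_mxEr.
  by rewrite coord_le_norm.
by rewrite coord_le_norm orbT.
Qed.

Lemma is_diff_submx (R : realType) n p (z : 'rV[R]_(n + p)) :
  is_diff z (fun z => (lsubmx z, rsubmx z)) (fun z => (lsubmx z, rsubmx z)).
Proof.
have dl : is_diff z (@lsubmx R 1 n p) lsubmx.
  apply: DiffDef; first exact: differentiable_lsubmx.
  by rewrite diff_lin//; exact: continuous_lsubmx.
have dr : is_diff z (@rsubmx R 1 n p) rsubmx.
  apply: DiffDef; first exact: differentiable_rsubmx.
  by rewrite diff_lin//; exact: continuous_rsubmx.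
exact: is_diff_pair.
Qed.

(** Taylor formula of a smooth extension of the retraction at the points (x, 0) of
    the zero section, where its derivative in the direction (0, v) is v. Working
    in a neighbourhood of (xs, 0) in the product makes the remainder uniform in
    the foot point x. *)
Lemma retraction_estimate (R : realType) M (S : set 'rV[R]_M)
    (U : set ('rV[R]_M * 'rV[R]_M)) (Ret : 'rV[R]_M * 'rV[R]_M -> 'rV[R]_M) xs :
  retraction S U Ret -> S xs -> tangent_space S xs 0 ->
  (forall x v t, S x -> tangent_space S x v -> tangent_space S x (t *: v)) ->
  exists2 K : R, 0 <= K & exists2 r : R, 0 < r &
  forall x v, S x -> tangent_space S x v -> `|x - xs| < r -> `|v| < r ->
    U (x, v) /\ `|Ret (x, v) - x - v| <= K * `|v| ^+ 2.
Proof.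
move=> [_ _ Ret_at] Sxs T0 TZ.
have [_ [A1 A1xs [A1U Ret_smooth Ret_diff]]] := Ret_at xs Sxs.
have [A2 [G [A2xs G_smooth RetG]]] :=
  Ret_smooth (xs, 0) (conj A1xs.2 (conj Sxs T0)).
pose L (z : 'rV[R]_(M + M)) : 'rV[R]_M * 'rV[R]_M := (lsubmx z, rsubmx z).
have LE x v : L (row_mx x v) = (x, v) by rewrite /L row_mxKl row_mxKr.
have Ld z : is_diff z L L by exact: is_diff_submx.
have Lc : continuous L.
  by move=> z; apply: differentiable_continuous; have [] := Ld z.
pose O := L @^-1` (A1 `&` A2).
have O_open : open O.
  by apply: open_comp; [move=> z _; exact: Lc|exact: openI A1xs.1 A2xs.1].
have Oxs : O (row_mx xs 0).
  by rewrite /O /= LE; split; [exact: A1xs.2|exact: A2xs.2].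
have GC k : class_C k (L @^-1` A2) (G \o L).
  exact: class_C_comp_affine Ld A2xs.1 (G_smooth k).
have xsO2 : open_nbhs (row_mx xs 0) (L @^-1` A2).
  split; last by rewrite /= LE; exact: A2xs.2.
  by apply: open_comp; [move=> z _; exact: Lc|exact: A2xs.1].
have [K K0 [r1 r10 GE]] := C2_estimates xsO2 (GC 2%N).
have /near_norm[r2 r20 rO] : \forall z \near row_mx xs (0 : 'rV[R]_M), O z.
  by apply: open_nbhs_nbhs.
exists K => //; exists (Num.min r1 r2); first by rewrite lt_min r10.
move=> x v Sx Tv; rewrite !lt_min => /andP[x1 x2] /andP[v1 v2].
have near_xs (w : 'rV[R]_M) r : `|x - xs| < r -> `|w| < r ->
    `|row_mx x w - row_mx xs 0| < r.
  move=> xr wr; rewrite opp_row_mx add_row_mx subr0.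
  by rewrite (le_lt_trans (norm_row_mx_le _ _))// gt_max xr.
have Oxv : O (row_mx x v) by apply: rO; exact: near_xs.
have Ox0 : O (row_mx x 0) by apply: rO; apply: near_xs => //; rewrite normr0.
have RetGE w : tangent_space S x w -> O (row_mx x w) ->
    Ret (x, w) = (G \o L) (row_mx x w).
  by move=> Tw; rewrite /O /= LE => -[A1w A2w]; apply: RetG.
have T0x : tangent_space S x 0 by rewrite -(scale0r v); exact: TZ.
split.
  by apply: A1U; split=> //; move: Oxv; rewrite /O /= LE => -[].
have z1 : `|row_mx x (0 : 'rV[R]_M) - row_mx xs 0| < r1.
  by apply: near_xs => //; rewrite normr0.
have [_ _ /(_ (row_mx x v) (near_xs _ _ x1 v1))[_ _ taylor]] := GE _ z1.
have dE : row_mx x v - row_mx x 0 = row_mx 0 v.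
  by rewrite opp_row_mx add_row_mx subrr subr0.
have RetE0 : (G \o L) (row_mx x 0) = x.
  by rewrite -RetGE//; have [] := Ret_at x Sx.
have dG : 'd (G \o L) (row_mx x 0) (row_mx 0 v) = v.
  have A1x : A1 (x, 0) by move: Ox0; rewrite /O /= LE => -[].
  have lineE (t : R) :
      row_mx x (t *: v) = row_mx x 0 + t *: row_mx 0 v :> 'rV[R]_(M + M).
    by rewrite scale_row_mx add_row_mx scaler0 addr0 add0r.
  have nearO : \forall t \near (0 : R), O (row_mx x (t *: v)).
    pose l (t : R) : 'rV[R]_(M + M) := row_mx x 0 + t *: row_mx 0 v.
    have lc : l t @[t --> (0 : R)] --> l 0.
      apply: differentiable_continuous; apply/derivable1_diffP.
      by have [] := is_derive_line (row_mx x 0) (row_mx 0 v : 'rV[R]_(M + M)) 0.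
    have : \forall t \near (0 : R), O (l t).
      apply: lc; apply: open_nbhs_nbhs.
      by split=> //; rewrite /l scale0r addr0.
    by apply: filterS => t; rewrite lineE.
  have : is_derive (0 : R) 1 (fun t : R => Ret (x, t *: v))
      ('d (G \o L) (row_mx x 0) (row_mx 0 v)).
    apply: (@near_eq_is_derive _ _ _ ((G \o L) \o
      (fun t : R => row_mx x 0 + t *: row_mx 0 v))).
      by apply: filterS nearO => t Ot; rewrite RetGE//= -?lineE//; exact: TZ.
    apply: is_derive_curve.
    - by rewrite scale0r addr0.
    - exact: is_derive_line.
    - by apply: (GC 1%N).1; move: Ox0; rewrite /O /= LE => -[].
  move=> [_ <-].
  by have [_] := Ret_diff x Sx A1x v Tv.
have vE : `|row_mx (0 : 'rV[R]_M) v| <= `|v|.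
  by rewrite (le_trans (norm_row_mx_le _ _))// normr0 ge_max normr_ge0 lexx.
move: taylor; rewrite -RetGE// RetE0 dE dG => /le_trans; apply.
by rewrite ler_wpM2l// ler_pXn2r ?nnegrE.
Qed.

(** * One step of the Gauss-Newton method *)

Lemma near_enorm (R : realType) n (p : 'rV[R]_n) (P : set 'rV[R]_n) :
  (\forall x \near p, P x) <->
  exists2 r : R, 0 < r & forall x, enorm (x - p) <= r -> P x.
Proof.
split=> [/near_norm[r r0 rP]|[r r0 rP]].
  exists (r / 2) => [|x xr]; first by rewrite divr_gt0.
  by apply: rP; rewrite (le_lt_trans (norm_le_enorm _))// (le_lt_trans xr)//; lra.
apply/near_norm; exists (r / (n%:R + 1)) => [|x xr].
  by rewrite divr_gt0// ltr_wpDl.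
apply: rP; apply: (le_trans (enorm_le_norm _)).
have n1 : 0 < n%:R + 1 :> R by rewrite ltr_wpDl.
move: xr; rewrite ltr_pdivlMr// mulrDr mulr1 mulrC => /ltW.
by apply: le_trans; rewrite lerDl.
Qed.

Lemma enorm_mulmx_orthonormal (R : realType) m n (B : 'M[R]_(m, n)) u :
  B *m B^T = 1%:M -> enorm (u *m B) = enorm u.
Proof.
move=> BB; apply/eqP; rewrite -(@eqrXn2 _ 2) ?enorm_ge0// !sqr_enorm.
by rewrite dot_mulmxl -mulmxA BB mulmx1.
Qed.

Lemma error_split (V : zmodType) (a r x eta w : V) :
  a - r = (a - x - w) - (eta - w) - (r - x - eta).
Proof.
rewrite opprB addrA subrK -(addrA a) -(addrA r) -opprD [- (r - _)]opprB.
by rewrite addrA subrK.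
Qed.

Section GaussNewton.
Variables (R : realType) (M N m : nat) (S : set 'rV[R]_M).
Hypotheses (m_leM : (m <= M)%N) (S_submanifold : embedded_submanifold m S).
Variables (F : 'rV[R]_M -> 'rV[R]_N).
Hypothesis F_smooth : smooth_on S F.

Lemma submanifold_tangent_onb x : S x ->
  tangent_onb S m x *m (tangent_onb S m x)^T = 1%:M /\
  forall v, tangent_space S x v <-> (v <= tangent_onb S m x)%MS.
Proof.
move=> Sx; have [A [W [Phi [Psi [Ax W_open Phi_sm Psi_sm [im PhiK SE]]]]]] :=
  S_submanifold Sx.
by apply: (@tangent_onbP _ _ _ _ A W Phi Psi) => //; [exact: Ax.1|exact: Ax.2].
Qed.

Lemma tangent_mul_onb x (a : 'rV[R]_m) : S x ->
  tangent_space S x (a *m tangent_onb S m x).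
Proof. by move=> Sx; apply/(submanifold_tangent_onb Sx).2; exact: submxMl. Qed.

Lemma tangent0 x : S x -> tangent_space S x 0.
Proof. by move=> Sx; have := tangent_mul_onb 0 Sx; rewrite mul0mx. Qed.

Lemma tangentB x u v : S x -> tangent_space S x u -> tangent_space S x v ->
  tangent_space S x (u - v).
Proof.
move=> Sx; have [_ TP] := submanifold_tangent_onb Sx.
move=> /TP /submxP[a ->] /TP /submxP[b ->].
by rewrite -mulmxBl; exact: tangent_mul_onb.
Qed.

Lemma tangentZ x v (t : R) : S x -> tangent_space S x v ->
  tangent_space S x (t *: v).
Proof.
move=> Sx; have [_ TP] := submanifold_tangent_onb Sx.
by move=> /TP /submxP[a ->]; rewrite scalemxAl; exact: tangent_mul_onb.
Qed.

(** The rows of the matrix are the images of an orthonormal basis, so a linear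
    relation between them is a tangent vector in the kernel of the
    derivative. *)
Lemma mdiff_mx_row_free x : S x -> mdiff_injective S F x ->
  row_free (mdiff_mx S m F x).
Proof.
move=> Sx Finj; have [A [Fe [Ax Fe_sm FE]]] := F_smooth Sx.
have Fed y : A y -> differentiable Fe y by exact: (Fe_sm 1%N).1.
have BT i : tangent_space S x (row i (tangent_onb S m x)).
  by apply/(submanifold_tangent_onb Sx).2; exact: row_sub.
rewrite (mdiff_mxE Ax.1 Fed FE Ax.2 BT).
apply: inj_row_free => v; rewrite mulmxA mul_jacobian => v0.
have vB0 : v *m tangent_onb S m x = 0.
  apply: Finj; [exact: tangent_mul_onb|exact: tangent0|].
  rewrite (mdiffE Ax.1 Fed FE Ax.2 (tangent_mul_onb v Sx)).
  rewrite (mdiffE Ax.1 Fed FE Ax.2 (tangent0 Sx)) v0.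
  by rewrite linear0.
have [BB _] := submanifold_tangent_onb Sx.
by rewrite -[v]mulmx1 -BB mulmxA vB0 mul0mx.
Qed.

Variables (U : set ('rV[R]_M * 'rV[R]_M)) (Ret : 'rV[R]_M * 'rV[R]_M -> 'rV[R]_M).
Hypothesis Ret_retraction : retraction S U Ret.
Variable xs : 'rV[R]_M.
Hypotheses (xs_in_S : S xs)
  (xs_local_min : \forall p \near xs, S p -> objective F xs <= objective F p)
  (dF_injective : mdiff_injective S F xs).

(** In the notation of the opening comment, the error of the new point is the sum of
    xs - x - w, w - eta and x + eta - Ret (x, eta). The first and the last are
    quadratic in the distance d, and only the second carries the term in
    F xs. *)
Lemma rgn_step_estimate : exists K1 K2 : R, [/\ 0 <= K1, 0 <= K2 &
  \forall x \near xs, S x ->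
  let x' := Ret (x, rgn_direction m S F x) in
  [/\ mdiff_injective S F x, U (x, rgn_direction m S F x) &
  enorm (xs - x') <=
    K1 * enorm (F xs) * enorm (x - xs) + K2 * enorm (x - xs) ^+ 2]].
Proof.
have [A [Fe [Axs Fe_sm FE]]] := F_smooth xs_in_S.
have Fed y : A y -> differentiable Fe y by exact: (Fe_sm 1%N).1.
have [V [W [Phi [Psi [Vxs W_open Phi_sm Psi_sm [im PhiK SE]]]]]] :=
  S_submanifold xs_in_S.
have [K K0 nearK] := tangent_estimates Vxs.1 W_open Phi_sm Psi_sm im PhiK SE
  Vxs.2 xs_in_S Axs Fe_sm.
have [KR KR0 [rR rR0 RetE]] :=
  retraction_estimate Ret_retraction xs_in_S (tangent0 xs_in_S) tangentZ.
have mdiff_mx_x x : S x -> A x ->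
    mdiff_mx S m F x = tangent_onb S m x *m 'J Fe x.
  move=> Sx Ax; apply: (mdiff_mxE Axs.1 Fed FE Ax) => i.
  by apply/(submanifold_tangent_onb Sx).2; exact: row_sub.
have [Kc Kc0 Kc_le] : exists2 Kc : R, 0 < Kc &
    forall y, tangent_space S xs y -> enorm y <= Kc * enorm ('d Fe xs y).
  have /row_freeP[C BC] := mdiff_mx_row_free xs_in_S dF_injective.
  have [Kc Kc0 KcE] := enorm_mulmx_bounded C; exists Kc => // y.
  have [BB TP] := submanifold_tangent_onb xs_in_S.
  move=> /TP /submxP[a ->]; rewrite enorm_mulmx_orthonormal//.
  rewrite -[a in leLHS]mulmx1 -BC mulmxA (le_trans (KcE _))//.
  by rewrite mdiff_mx_x ?mulmxA ?mul_jacobian//; exact: Axs.2.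
(* The differential of F is bounded below by (2 Kc)^-1 on the tangent spaces near
   xs, which turns the bound of pinv_inj_estimate on eta - w into
   K1 |F xs| e + 2 Kc K e^2, where e is the distance from x to xs; for e <= 1
   this leaves |eta| <= Keta e. *)
pose K1 := 4 * Kc ^+ 2 * K.
pose Keta := 1 + K + K1 * enorm (F xs) + 2 * Kc * K.
pose K2 := K + 2 * Kc * K + M%:R * KR * Keta ^+ 2.
have Fs0 := enorm_ge0 (F xs).
have KcK : 0 <= 2 * Kc * K by rewrite !mulr_ge0// ltW.
have K10 : 0 <= K1 by rewrite /K1 !mulr_ge0// ltW.
have K1F : 0 <= K1 * enorm (F xs) by rewrite mulr_ge0.
have Keta0 : 0 < Keta by rewrite /Keta; lra.
exists K1, K2; split=> //.
  by rewrite /K2 addr_ge0 ?mulr_ge0// ?sqr_ge0// ?addr_ge0.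
have near_e (d : R) : 0 < d -> \forall x \near xs, enorm (x - xs) <= d.
  by move=> d0; apply/near_enorm; exists d.
have near1 := near_e 1 ltr01.
have near2 : \forall x \near xs, enorm (x - xs) <= (2 * (Kc + 1) * (K + 1))^-1.
  by apply: near_e; rewrite invr_gt0 !mulr_gt0//; lra.
have near3 : \forall x \near xs, enorm (x - xs) <= rR / (Keta + 1).
  by apply: near_e; rewrite divr_gt0// addr_gt0.
near=> x; move=> Sx /=.
have e1 : enorm (x - xs) <= 1 by near: x.
have e2 : enorm (x - xs) <= (2 * (Kc + 1) * (K + 1))^-1 by near: x.
have e3 : enorm (x - xs) <= rR / (Keta + 1) by near: x.
have [_ Ax [w Tw [wE FwE]] Tx_lip] : [/\ V x, A x,
    exists2 w, tangent_space S x w &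
      enorm (xs - x - w) <= K * enorm (x - xs) ^+ 2 /\
      enorm (Fe xs - Fe x - 'd Fe x w) <= K * enorm (x - xs) ^+ 2 &
    forall y, tangent_space S x y -> exists2 y', tangent_space S xs y' &
      enorm (y - y') <= K * enorm (x - xs) * enorm y /\
      enorm ('d Fe x y - 'd Fe xs y') <= K * enorm (x - xs) * enorm y].
  by move: Sx; near: x.
set e := enorm (x - xs) in e1 e2 e3 wE FwE Tx_lip *.
have e0 : 0 <= e := enorm_ge0 _.
have Ke : (Kc + 1) * (K * e) <= 2^-1.
  move: e2; rewrite -[leRHS]mul1r ler_pdivlMr ?mulr_gt0//; try lra.
  have : 0 <= (Kc + 1) * e by rewrite mulr_ge0//; lra.
  lra.
have [D DJ DE] : exists2 D, 'J Fe x = D & forall v, 'd Fe x v = v *m D.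
  by exists ('J Fe x) => [|v]; [|exact/esym/mul_jacobian].
have [Ds DsE] : exists D, forall v, 'd Fe xs v = v *m D.
  exists ('J Fe xs) => v; exact/esym/mul_jacobian.
have mdiffD v : tangent_space S x v -> mdiff S F x v = v *m D.
  by move=> Tv; exact: etrans (mdiffE Axs.1 Fed FE Ax Tv) (DE v).
have mdiff_mxD : mdiff_mx S m F x = tangent_onb S m x *m D.
  by rewrite -DJ; exact: mdiff_mx_x.
have Fs_ortho y : tangent_space S xs y -> dot (F xs) (y *m Ds) = 0.
  by rewrite -(DsE y); exact: (local_min_dot_eq0 Axs.1 Fed FE Axs.2 xs_local_min).
rewrite DE -(FE _ Axs.2 xs_in_S) -(FE _ Ax Sx) in FwE.
have {}Tx_lip y : tangent_space S x y -> exists2 y', tangent_space S xs y' &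
    enorm (y - y') <= K * e * enorm y /\
    enorm (y *m D - y' *m Ds) <= K * e * enorm y.
  move=> Ty; have [y' Ty' [yy' dyy']] := Tx_lip y Ty.
  exists y'; first exact: Ty'.
  by split; [exact: yy'|rewrite -(DE y) -(DsE y'); exact: dyy'].
have {}Kc_le y : tangent_space S xs y -> enorm y <= Kc * enorm (y *m Ds).
  by rewrite -(DsE y); exact: Kc_le.
(* Compare y with its neighbour y' in the tangent space at xs, where Kc_le
   applies: the comparison costs (Kc + 1) K e, which is at most one half. *)
have D_le y : tangent_space S x y -> enorm y <= 2 * Kc * enorm (y *m D).
  move=> Ty; have [y' Ty' [yy' dyy']] := Tx_lip y Ty.
  have y_le : enorm y <= enorm (y - y') + enorm y'.
    by rewrite -{1}(subrK y' y) enormD.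
  have y'D_le : enorm (y' *m Ds) <= enorm (y *m D - y' *m Ds) + enorm (y *m D).
    by rewrite enormB -{1}(subrK (y *m D) (y' *m Ds)) enormD.
  have := Kc_le y' Ty'.
  have : Kc * enorm (y' *m Ds) <= Kc * (K * e * enorm y + enorm (y *m D)).
    by rewrite ler_wpM2l ?(ltW Kc0)// (le_trans y'D_le)// lerD2r.
  have : (Kc + 1) * (K * e) * enorm y <= 2^-1 * enorm y.
    by rewrite ler_wpM2r ?enorm_ge0.
  lra.
have [BB TP] := submanifold_tangent_onb Sx.
have /TP /submxP[om wB] := Tw.
clear DE DsE DJ mdiff_mx_x.
set B := tangent_onb S m x in BB TP wB mdiff_mxD *.
pose J := mdiff_mx S m F x.
pose rho := F x - F xs + w *m D.
have rhoE : enorm rho <= K * e ^+ 2.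
  by rewrite -enormN /rho opprD opprB.
have FxE : F x = F xs - om *m J + rho.
  by rewrite /rho /J mdiff_mxD mulmxA -wB addrACA addNr addr0 addrC subrK.
have sig0 : 0 < (2 * Kc)^-1 by rewrite invr_gt0 mulr_gt0.
have delta0 : 0 <= K * e * enorm (F xs) by rewrite !mulr_ge0.
have A_low y : (2 * Kc)^-1 * enorm y <= enorm (y *m J).
  rewrite ler_pdivrMl ?mulr_gt0// /J mdiff_mxD mulmxA.
  by rewrite -(enorm_mulmx_orthonormal y BB) D_le//; exact: tangent_mul_onb.
have A_dot y : `|dot (F xs) (y *m J)| <= K * e * enorm (F xs) * enorm y.
  have [y' Ty' [_ yy']] := Tx_lip _ (tangent_mul_onb y Sx).
  rewrite /J mdiff_mxD mulmxA -[_ *m D](subrK (y' *m Ds)) dotDr.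
  rewrite (Fs_ortho _ Ty') addr0 (le_trans (normr_dot_le _ _))//.
  rewrite -(enorm_mulmx_orthonormal y BB) mulrC mulrAC ler_wpM2r//.
have := @pinv_inj_estimate _ _ _ J _ om (F xs) rho _ sig0 delta0 A_low A_dot.
rewrite -FxE exprVn !invrK; set th := - _ => step.
pose eta := rgn_direction m S F x.
have etaE : eta = th *m B by rewrite /eta /rgn_direction mulNmx.
have Teta : tangent_space S x eta by rewrite etaE; exact: tangent_mul_onb.
rewrite -/eta.
have eta_w : enorm (eta - w) <= K1 * enorm (F xs) * e + 2 * Kc * K * e ^+ 2.
  rewrite etaE wB -mulmxBl enorm_mulmx_orthonormal// (le_trans step)//.
  apply: lerD; first by rewrite /K1 le_eqVlt; apply/orP; left; apply/eqP; ring.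
  by rewrite -(mulrA (2 * Kc)) mulrC ler_wpM2l// ltW// mulr_gt0.
have e_le : e ^+ 2 <= e by rewrite expr2 ler_piMr.
have w_le : enorm w <= e + K * e ^+ 2.
  rewrite -{1}(subrK (xs - x) w) (le_trans (enormD _ _))// addrC.
  by apply: lerD; rewrite enormB.
have eta_le : enorm eta <= Keta * e.
  rewrite -(subrK w eta) (le_trans (enormD _ _))//.
  apply: (le_trans (lerD eta_w w_le)); rewrite /Keta.
  have := ler_wpM2l K0 e_le; have := ler_wpM2l KcK e_le.
  move: (K1 * enorm (F xs)) (2 * Kc * K) (e ^+ 2) => k1 k2 e'; lra.
have Keta1 : 0 < Keta + 1 by rewrite addr_gt0.
have Keta_rR : (Keta + 1) * e <= rR by rewrite mulrC -ler_pdivlMr.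
have e_rR : e < rR.
  have [e0'|e0'] := eqVneq e 0; first by rewrite e0'.
  apply: lt_le_trans Keta_rR; rewrite [ltRHS]mulrDl mul1r ltrDr mulr_gt0//.
  by rewrite lt0r e0'.
have eta_rR : enorm eta < rR.
  have [e0'|e0'] := eqVneq e 0.
    by move: eta_le; rewrite e0' mulr0 => /le_lt_trans; apply.
  apply: le_lt_trans eta_le _; apply: lt_le_trans Keta_rR.
  by rewrite [ltRHS]mulrDl mul1r ltrDl lt0r e0'.
have [Ueta Ret_le] := RetE x eta Sx Teta
  (le_lt_trans (norm_le_enorm _) e_rR) (le_lt_trans (norm_le_enorm _) eta_rR).
split; last 1 first.
- have Ret_e : enorm (Ret (x, eta) - x - eta) <= M%:R * KR * Keta ^+ 2 * e ^+ 2.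
    apply: (le_trans (enorm_le_norm _)); rewrite -!mulrA ler_wpM2l//.
    apply: (le_trans Ret_le); rewrite ler_wpM2l// mulrA -expr2 -exprMn.
    rewrite ler_pXn2r ?nnegrE ?mulr_ge0//; last exact: ltW.
    exact: le_trans (norm_le_enorm _) eta_le.
  rewrite (error_split xs (Ret (x, eta)) x eta w).
  apply: (le_trans (enormD _ _)); rewrite enormN.
  have := enormD (xs - x - w) (- (eta - w)); rewrite enormN /K2 !mulrDl.
  lra.
- move=> u v Tu Tv; rewrite mdiffD// mdiffD// => uv.
  apply/eqP; rewrite -subr_eq0; apply/eqP/enorm_eq0/le_anti.
  rewrite enorm_ge0 andbT; apply: (le_trans (D_le _ (tangentB Sx Tu Tv))).
  by rewrite mulmxBl uv subrr enorm0 mulr0.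
- exact: Ueta.
Unshelve. all: by end_near. Qed.
End GaussNewton.

(** * Convergence *)

Lemma contraction_cvg (R : realType) n (x : nat -> 'rV[R]_n) (l : 'rV[R]_n)
    (q : R) : 0 <= q < 1 ->
  (forall k, enorm (l - x k.+1) <= q * enorm (l - x k)) -> x @ \oo --> l.
Proof.
move=> /andP[q0 q1] xq.
have geo k : enorm (l - x k) <= q ^+ k * enorm (l - x 0%N).
  elim: k => [|k IHk]; first by rewrite expr0 mul1r.
  by rewrite (le_trans (xq k))// exprS -mulrA ler_wpM2l.
have geo0 : q ^+ k * enorm (l - x 0%N) @[k --> \oo] --> 0 * enorm (l - x 0%N).
  by apply: cvgMr_tmp; apply: cvg_expr; rewrite ger0_norm.
apply/cvgrPdist_lt => d d0.
rewrite mul0r in geo0.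
near=> k; apply: le_lt_trans (le_trans (norm_le_enorm _) (geo k)) _.
by near: k; exact: cvgr_lt geo0 d d0.
Unshelve. all: by end_near. Qed.

Theorem theorem1 (R : realType) (M N m : nat) (m_gt0 : (0 < m)%N)
    (m_leM : (m <= M)%N) (S : set 'rV[R]_M)
    (S_submanifold : embedded_submanifold m S)
    (F : 'rV[R]_M -> 'rV[R]_N) (F_smooth : smooth_on S F)
    (U : set ('rV[R]_M * 'rV[R]_M)) (Ret : 'rV[R]_M * 'rV[R]_M -> 'rV[R]_M)
    (Ret_retraction : retraction S U Ret)
    (xs : 'rV[R]_M) (xs_in_S : S xs)
    (xs_local_min : \forall p \near xs, S p -> objective F xs <= objective F p)
    (dF_injective : mdiff_injective S F xs) :
  let kappa := (singular_value m (mdiff_mx S m F xs))^-1 in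
  0 < kappa /\
  exists2 eps' : R, 0 < eps' &
  exists2 c : R, 0 < c &
  forall alpha : R, 0 < alpha < 1 ->
    (let rate := c * kappa ^+ 2 * enorm (F xs) / alpha in
     let eps := Num.min ((1 - alpha) / (c * kappa))
       (alpha * eps' / (1 + alpha + c * kappa ^+ 2 * enorm (F xs))) in
     rate < 1 ->
     exists2 C : R, 0 <= C &
     forall x0, (eball xs eps `&` S) x0 ->
       let x := rgn m S F Ret x0 in
       [/\ rgn_well_defined m S F U Ret x0,
           converges_linearly x xs &
           forall k, enorm (xs - x k.+1) <=
             rate * enorm (xs - x k) + C * enorm (xs - x k) ^+ 2]) /\
    (let eps := Num.min ((1 - alpha) / (c * kappa))
       (alpha * eps' / (1 + alpha)) in
     objective F xs = 0 ->
     exists2 C : R, 0 <= C &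
     forall x0, (eball xs eps `&` S) x0 ->
       let x := rgn m S F Ret x0 in
       [/\ rgn_well_defined m S F U Ret x0,
           converges_quadratically x xs &
           forall k, enorm (xs - x k.+1) <=
             c * (kappa + 1) / alpha * enorm (xs - x k) ^+ 2 +
             C * enorm (xs - x k) ^+ 3]).
Proof.
move=> kappa.
have kappa0 : 0 < kappa.
  rewrite invr_gt0; apply: singular_value_gt0 => //.
  exact: mdiff_mx_row_free dF_injective.
split=> //.
have [K1 [K2 [K10 K20 /near_enorm[r r0 rP]]]] :=
  rgn_step_estimate m_leM S_submanifold F_smooth Ret_retraction xs_in_S
    xs_local_min dF_injective.
exists r => //.
pose c := K1 / kappa ^+ 2 + 2 * K2 / kappa + 1.
have c0 : 0 < c.
  by rewrite /c ltr_wpDl// addr_ge0// divr_ge0 ?exprn_ge0 ?mulr_ge0// ltW.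
have cK1 : K1 <= c * kappa ^+ 2.
  rewrite -ler_pdivrMr ?exprn_gt0// /c -addrA lerDl addr_ge0//.
  by rewrite divr_ge0 ?mulr_ge0// ltW.
have cK2 : 2 * K2 <= c * kappa.
  rewrite -ler_pdivrMr// /c -addrA addrCA lerDl addr_ge0//.
  by rewrite divr_ge0// exprn_ge0// ltW.
clearbody c; exists c => // alpha /andP[alpha0 alpha1].
set f := enorm (F xs); have f0 : 0 <= f := enorm_ge0 _.
have c2 : 0 <= c * kappa ^+ 2 * f.
  by rewrite !mulr_ge0 ?exprn_ge0// ltW.
pose q := (1 + alpha) / 2.
have q01 : 0 < q < 1 by rewrite /q; lra.
(* The two conditions on eps and the bound on the rate split the contraction
   factor q: the linear term of the step estimate contributes less than alpha,
   the quadratic one at most (1 - alpha) / 2. *)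
have iterates eps x0 : eps <= (1 - alpha) / (c * kappa) -> eps <= r ->
    c * kappa ^+ 2 * f < alpha -> enorm (x0 - xs) <= eps -> S x0 ->
  let x := rgn m S F Ret x0 in
  [/\ rgn_well_defined m S F U Ret x0,
      forall k, enorm (xs - x k.+1) <= q * enorm (xs - x k) &
      forall k, enorm (xs - x k.+1) <=
        K1 * f * enorm (xs - x k) + K2 * enorm (xs - x k) ^+ 2].
  move=> eps_le1 eps_r rate_lt x0_eps Sx0 x.
  have step y : S y -> enorm (xs - y) <= eps ->
      let y' := Ret (y, rgn_direction m S F y) in
      [/\ mdiff_injective S F y, U (y, rgn_direction m S F y), S y',
          enorm (xs - y') <= q * enorm (xs - y) &
          enorm (xs - y') <= K1 * f * enorm (xs - y) + K2 * enorm (xs - y) ^+ 2].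
    move=> Sy y_eps y'.
    have [] := rP y _ Sy; first by rewrite enormB (le_trans y_eps).
    rewrite -/y' -/f (enormB y) => Finj Uy y'_le.
    have [_ RS _] := Ret_retraction.
    split=> //; first exact: RS.
    apply: (le_trans y'_le); set e := enorm (xs - y) in y_eps *.
    have e0 : 0 <= e := enorm_ge0 _.
    rewrite expr2 mulrA -mulrDl ler_wpM2r//.
    have : K1 * f <= c * kappa ^+ 2 * f by rewrite ler_wpM2r.
    have : 2 * K2 * e <= c * kappa * e by rewrite ler_wpM2r.
    have : c * kappa * e <= 1 - alpha.
      by rewrite mulrC -ler_pdivlMr ?mulr_gt0// (le_trans y_eps).
    rewrite /q; lra.
  have inv k : S (x k) /\ enorm (xs - x k) <= eps.
    elim: k => [|k [Sk ek]]; first by rewrite enormB.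
    have [_ _ S' q' _] := step _ Sk ek; split=> //.
    apply: (le_trans q'); apply: le_trans ek.
    by rewrite ler_piMl ?enorm_ge0//; case/andP: q01 => _ /ltW.
  by split=> k; have [Sk ek] := inv k; have [] := step _ Sk ek.
split=> [rate eps rate1|eps obj0].
  exists K2 => // x0 [x0_eps Sx0] x.
  have cf_lt : c * kappa ^+ 2 * f < alpha by move: rate1; rewrite ltr_pdivrMr ?mul1r.
  have eps_c : eps <= (1 - alpha) / (c * kappa) by rewrite ge_min lexx.
  have eps_r : eps <= r.
    rewrite ge_min; apply/orP; right; rewrite ler_pdivrMr; last by lra.
    by rewrite mulrC ler_wpM2l ?(ltW r0)//; lra.
  have [wd lin quad] := iterates eps x0 eps_c eps_r cf_lt x0_eps Sx0.
  split=> //.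
    split; last by exists q => //; near=> k; exact: lin.
    by apply: contraction_cvg lin; case/andP: q01 => /ltW-> ->.
  move=> k; apply: (le_trans (quad k)); rewrite lerD2r ler_wpM2r ?enorm_ge0//.
  rewrite /rate ler_pdivlMr//.
  apply: le_trans (ler_wpM2r f0 cK1); rewrite ler_piMr ?mulr_ge0//; exact: ltW.
have f_eq0 : f = 0.
  apply/eqP; move/eqP: obj0; rewrite /objective mulf_eq0 invr_eq0 pnatr_eq0/=.
  by rewrite sqrf_eq0.
exists 0 => // x0 [x0_eps Sx0] x.
have eps_c : eps <= (1 - alpha) / (c * kappa) by rewrite ge_min lexx.
have eps_r : eps <= r.
  rewrite ge_min; apply/orP; right; rewrite ler_pdivrMr; last by lra.
  by rewrite mulrC ler_wpM2l ?(ltW r0)//; lra.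
have cf_lt : c * kappa ^+ 2 * f < alpha by rewrite f_eq0 mulr0.
have [wd lin quad] := iterates eps x0 eps_c eps_r cf_lt x0_eps Sx0.
have quad' k : enorm (xs - x k.+1) <= K2 * enorm (xs - x k) ^+ 2.
  by have := quad k; rewrite f_eq0 mulr0 mul0r add0r.
split=> //.
  split; first by apply: contraction_cvg lin; case/andP: q01 => /ltW-> ->.
  exists (K2 + 1); first by rewrite ltr_wpDl.
  near=> k; apply: (le_trans (quad' k)).
  by rewrite ler_wpM2r ?sqr_ge0// lerDl.
move=> k; rewrite mul0r addr0; apply: (le_trans (quad' k)).
rewrite ler_wpM2r ?sqr_ge0// ler_pdivlMr//.
have : K2 * alpha <= K2 by rewrite ler_piMr// ltW.
lra.
Unshelve. all: by end_near. Qed.
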